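(* Let $\mu$ be a bounded (complex) regular Borel measure on $\mathbb R$. Let $g:\mathbb R\to\mathbb C$ be a bounded function with $g\in X_{-1}$ whose set of discontinuities $Z=\{x_1,x_2,x_3,\ldots\}$ is discrete and consists only of jump discontinuities, and put $a_n:=\lim_{t\nearrow x_n}g(t)$, $b_n:=\lim_{t\searrow x_n}g(t)$ for each $n$. For $f\in \mathrm C_{\mathrm b}(\mathbb R)$ write $\Phi(f):=\int_{\mathbb R}f\,\mathrm d\mu$. Then the operator $(C,D(C))$ given by $$Cf=f'+\int_{\mathbb R}f\,\mathrm d\mu\cdot g,$$ $$D(C)=\Bigl\{f\in \mathrm C_{\mathrm b}(\mathbb R):\ f\in \mathrm C^1_{\mathrm b}(\mathbb R\setminus Z),\ \lim_{t\nearrow x_n}f'(t)-\lim_{t\searrow x_n}f'(t)=\Phi(f)(b_n-a_n)\ \text{ for each } n\Bigr\}$$ generates a $\tau_{\mathrm{co}}$-bi-continuous semigroup on $\mathrm C_{\mathrm b}(\mathbb R)$.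
   Context: $\mathrm C_{\mathrm b}(\mathbb R)$ is the Banach space of bounded continuous functions on $\mathbb R$ with the supremum norm, and $\tau_{\mathrm{co}}$ is the compact-open topology on it, generated by the seminorms $p_K(f)=\sup_{x\in K}|f(x)|$, $K\subseteq\mathbb R$ compact. $X_{-1}:=\{f-Df: f\in \mathrm C_{\mathrm b}(\mathbb R)\}$ is a space of distributions on $\mathbb R$, $Df$ being the distributional derivative; $g\in X_{-1}$ means that the distribution defined by $g$ lies in this space. $f\in\mathrm C^1_{\mathrm b}(\mathbb R\setminus Z)$ means that $f$ is differentiable at each point of $\mathbb R\setminus Z$ with $f'$ bounded and continuous on $\mathbb R\setminus Z$. The condition in $D(C)$ includes the existence of the one-sided limits of $f'$ at the points $x_n$. For $f\in D(C)$, the function $f'+\Phi(f)g$ on $\mathbb R\setminus Z$ extends uniquely to an element of $\mathrm C_{\mathrm b}(\mathbb R)$, and this is what $Cf$ denotes. A family $\mathcal B$ of bounded operators on $X=\mathrm C_{\mathrm b}(\mathbb R)$ is bi-equicontinuous if for each norm-bounded $\tau_{\mathrm{co}}$-null sequence $(f_n)$ one has $Bf_n\to0$ in $\tau_{\mathrm{co}}$ uniformly for $B\in\mathcal B$. A family $(S(t))_{t\ge0}$ of bounded linear operators on $X$ is a $\tau_{\mathrm{co}}$-bi-continuous semigroup if $S(t+s)=S(t)S(s)$, $S(0)=I$; $t\mapsto S(t)f$ is $\tau_{\mathrm{co}}$-continuous on $[0,\infty)$ for each $f\in X$; $\|S(t)\|\le Me^{\omega t}$ for some $M\ge1$, $\omega\in\mathbb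 R$ and all $t\ge0$; and $\{S(t):t\in[0,s]\}$ is bi-equicontinuous for every $s>0$. Its generator is the operator $f\mapsto\tau_{\mathrm{co}}\text{-}\lim_{t\to0}\frac{S(t)f-f}{t}$ whose domain consists of those $f\in X$ for which this $\tau_{\mathrm{co}}$-limit exists and $\sup_{t\in(0,1]}\frac{\|S(t)f-f\|}{t}<\infty$. *)

(* Defs.v *)
From HB Require Import structures.
From mathcomp Require Import all_boot all_order all_algebra.
From mathcomp Require Import all_classical all_reals all_analysis.
From mathcomp Require Import complex.

Set Implicit Arguments.
Unset Strict Implicit.
Unset Printing Implicit Defensive.

Import Order.TTheory GRing.Theory Num.Theory.
Import numFieldNormedType.Exports.

Local Open Scope classical_set_scope.
Local Open Scope ring_scope.
Local Open Scope complex_scope.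

(* The complex numbers are [Rcomplex R], the copy of [R[i]] which is both a
   field and a real vector space normed by the modulus.  We add the topology,
   so that limits and derivatives of complex-valued functions of a real variable
   are those of the library. *)
Section complex_normed_module.
Variable R : realType.

HB.instance Definition _ := isPointed.Build (Rcomplex R) 0.
HB.instance Definition _ :=
  PseudoMetric.copy (Rcomplex R) (pseudoMetric_normed (Rcomplex R)).
HB.instance Definition _ :=
  NormedZmod_PseudoMetric_eq.Build R (Rcomplex R) erefl.

Fact Rcomplex_normrZ (l : R) (z : Rcomplex R) : `|l *: z| = `|l| * `|z|.
Proof.
case: z => a b; rewrite /Num.norm/= !exprMn -mulrDr sqrtrM ?sqr_ge0//.
by rewrite sqrtr_sqr.
Qed.

HB.instance Definition _ :=
  PseudoMetricNormedZmod_Lmodule_isNormedModule.Build R (Rcomplex R)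
    Rcomplex_normrZ.

Lemma Rcomplex_normM (z w : Rcomplex R) :
  `|(z * w : Rcomplex R)| = `|z| * `|w|.
Proof. exact: ComplexField.Normc.normcM. Qed.

Lemma Rcomplex_norm_Re (z : Rcomplex R) : `|complex.Re z| <= `|z|.
Proof.
case: z => a b; rewrite /= -sqrtr_sqr [leRHS]/Num.norm/=.
by rewrite ler_wsqrtr// lerDl sqr_ge0.
Qed.

Lemma Rcomplex_norm_Im (z : Rcomplex R) : `|complex.Im z| <= `|z|.
Proof.
case: z => a b; rewrite /= -sqrtr_sqr [leRHS]/Num.norm/=.
by rewrite ler_wsqrtr// lerDr sqr_ge0.
Qed.

Lemma Rcomplex_cvgZl T (F : set_system T) {FF : Filter F} (a : Rcomplex R)
    (f : T -> Rcomplex R) (l : Rcomplex R) :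
  f @ F --> l -> (fun x => a * f x : Rcomplex R) @ F --> (a * l : Rcomplex R).
Proof.
move=> /cvgrPdist_lt fl; apply/cvgrPdist_lt => e e0.
have a1 : 0 < `|a| + 1 by rewrite ltr_wpDl.
near=> x; rewrite -(mulrBr (a : Rcomplex R)) Rcomplex_normM.
rewrite (@le_lt_trans _ _ ((`|a| + 1) * `|l - f x|))//.
  by rewrite ler_wpM2r// lerDl.
rewrite mulrC -ltr_pdivlMr//.
by near: x; apply: fl; rewrite divr_gt0.
Unshelve. all: by end_near. Qed.

End complex_normed_module.

Section Cb.
Variable R : realType.
Local Notation C := (Rcomplex R).

Definition Cb_pred : {pred (R -> C)} :=
  mem [set f : R -> C | continuous f /\ bounded_fun f].

Record Cb := MkCb { cb_fun :> R -> C ; _ : cb_fun \in Cb_pred }.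

HB.instance Definition _ := [isSub for cb_fun].
HB.instance Definition _ := [Choice of Cb by <:].

Lemma bounded_funP (f : R -> C) :
  bounded_fun f <-> exists M : R, forall x, `|f x| <= M.
Proof.
have FF : ProperFilter (globally [set: R]).
  exact: (globally_properfilter (a := 0)).
split => [/ex_bound[M fM]|[M fM]]; first by exists M => x; exact: fM.
by apply/ex_bound; exists M => x _; exact: fM.
Qed.

Fact Cb_zmod_closed : zmod_closed Cb_pred.
Proof.
split; first by apply/mem_set; split; [exact: cst_continuous|exact: bounded_cst].
move=> f g /set_mem[fc /bounded_funP[M fM]] /set_mem[gc /bounded_funP[N gN]].
apply/mem_set; split; first by move=> x; apply: cvgB; [exact: fc|exact: gc].
apply/bounded_funP; exists (M + N) => x.
by rewrite (le_trans (ler_normB _ _))// lerD.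
Qed.

HB.instance Definition _ :=
  GRing.isZmodClosed.Build (R -> C) Cb_pred Cb_zmod_closed.
HB.instance Definition _ := [SubChoice_isSubZmodule of Cb by <:].
HB.instance Definition _ := isPointed.Build Cb 0.

Lemma Cb_continuous (f : Cb) : continuous f.
Proof. by case: f => f /= /set_mem[]. Qed.

Lemma Cb_bounded (f : Cb) : exists M : R, forall x, `|f x| <= M.
Proof. by case: f => f /= /set_mem[_ /bounded_funP]. Qed.

Fact Cb_scale_subproof (a : C) (f : Cb) :
  (fun x => a * f x : C) \in Cb_pred.
Proof.
have [M fM] := Cb_bounded f; apply/mem_set; split.
  by move=> x; apply: Rcomplex_cvgZl; exact: Cb_continuous.
apply/bounded_funP; exists (`|a| * M) => x.
by rewrite Rcomplex_normM ler_wpM2l.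
Qed.

Definition Cb_scale (a : C) (f : Cb) : Cb := MkCb (Cb_scale_subproof a f).

Lemma CbP (f g : Cb) : f =1 g -> f = g.
Proof. by move=> fg; apply/val_inj/funext. Qed.

Fact Cb_scaleA a b f : Cb_scale a (Cb_scale b f) = Cb_scale (a * b) f.
Proof. by apply: CbP => x /=; rewrite mulrA. Qed.
Fact Cb_scale1 : left_id 1 Cb_scale.
Proof. by move=> f; apply: CbP => x /=; rewrite mul1r. Qed.
Fact Cb_scaleDr : right_distributive Cb_scale +%R.
Proof. by move=> a f g; apply: CbP => x /=; rewrite mulrDr. Qed.
Fact Cb_scaleDl f : {morph Cb_scale^~ f : a b / a + b}.
Proof. by move=> a b; apply: CbP => x /=; rewrite mulrDl. Qed.

HB.instance Definition _ := GRing.Zmodule_isLmodule.Build C Cb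
  Cb_scaleA Cb_scale1 Cb_scaleDr Cb_scaleDl.

End Cb.

Section topologies_on_Cb.
Variable R : realType.
Implicit Types (f g h : Cb R) (K : set R).

Definition sup_norm f : R := sup [set `|f x| | x in [set: R]].

Definition co_seminorm K f : R := sup [set `|f x| | x in K].

(* Convergence for the topology generated by the seminorms [co_seminorm K],
   [K] compact; [co_cvgE] identifies it with the compact-open topology of the
   library. *)
Definition co_cvg {T : Type} (F : set_system T) (u : T -> Cb R) (f : Cb R) :=
  forall K, compact K -> co_seminorm K (u t - f) @[t --> F] --> (0 : R).

Lemma co_seminorm_ub K f x : K x -> `|f x| <= co_seminorm K f.
Proof.
move=> Kx; have [M fM] := Cb_bounded f; apply: ub_le_sup; last by exists x.
by exists M => _ [y _ <-].
Qed.

Lemma co_seminorm_le K f (M : R) :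
  0 <= M -> (forall x, K x -> `|f x| <= M) -> co_seminorm K f <= M.
Proof.
move=> M0 fM; have [->|/set0P[x Kx]] := eqVneq K set0.
  by rewrite /co_seminorm image_set0 sup0.
by apply: ge_sup; [exists `|f x|, x|move=> _ [y Ky <-]; exact: fM].
Qed.

Lemma co_seminorm_ge0 K f : 0 <= co_seminorm K f.
Proof.
have [->|/set0P[x Kx]] := eqVneq K set0.
  by rewrite /co_seminorm image_set0 sup0.
by rewrite (le_trans _ (co_seminorm_ub f Kx)).
Qed.

Lemma co_cvgE {T : Type} (F : set_system T) {FF : Filter F} (u : T -> Cb R) f :
  co_cvg F u f <->
  {compact-open, (fun t => u t : R -> Rcomplex R) @ F --> (f : R -> Rcomplex R)}.
Proof.
apply: iff_trans; last first.
  apply: iff_sym; apply: compact_open_fam_compactP; exact: Cb_continuous.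
apply: iff_trans; last by apply: iff_sym; exact: fam_cvgP.
split=> uf K cK.
  move=> A /uniform_nbhs[E [+ EA]].
  rewrite -entourage_ballE => -[e /= e0 eE].
  have /cvgrPdist_lt/(_ e e0) := uf K cK.
  apply: filterS => t; rewrite sub0r normrN ger0_norm ?co_seminorm_ge0// => ut.
  apply: EA => x Kx /=; apply: eE; rewrite /= -ball_normE /= distrC.
  exact: le_lt_trans (co_seminorm_ub (u t - f) Kx) ut.
apply/cvgrPdist_le => e e0.
have fK : nbhs (f : {uniform` K -> Rcomplex R})
    [set h : {uniform` K -> Rcomplex R} | forall x, K x -> ball (f x) e (h x)].
  apply/uniform_nbhs; exists [set xy | ball xy.1 e xy.2]; split => //.
  exact: (@entourage_ball R (Rcomplex R) (PosNum e0)).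
have uF : F [set t | forall x, K x -> ball (f x) e (u t x)] := uf K cK _ fK.
apply: filterS uF => t /= ut.
rewrite sub0r normrN ger0_norm ?co_seminorm_ge0//.
apply: co_seminorm_le; first exact: ltW.
move=> x Kx; have := ut x Kx; rewrite -ball_normE /= distrC => /ltW.
exact.
Qed.

Definition bi_equicontinuous (B : set (Cb R -> Cb R)) :=
  forall f : nat -> Cb R,
    (exists M : R, forall n, sup_norm (f n) <= M) ->
    co_cvg \oo f 0 ->
    forall K, compact K -> forall e : R, 0 < e ->
      \forall n \near \oo, forall T, B T -> co_seminorm K (T (f n)) < e.

(* A family indexed by [t >= 0]: the values [S t], [t < 0], are irrelevant. *)
Definition bi_continuous_semigroup (S : R -> {linear Cb R -> Cb R}) :=
  [/\ forall (t s : R) f, 0 <= t -> 0 <= s -> S (t + s) f = S t (S s f),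
      forall f, S 0 f = f,
      forall f (t : R), 0 <= t ->
        co_cvg (within `[0, +oo[%classic (nbhs t)) (S ^~ f) (S t f),
      exists M w : R, 1 <= M /\
        forall (t : R) f, 0 <= t -> sup_norm (S t f) <= M * expR (w * t) * sup_norm f &
      forall s : R, 0 < s ->
        bi_equicontinuous [set (S t : Cb R -> Cb R) | t in `[0, s]]].

Definition difference_quotient (S : R -> {linear Cb R -> Cb R}) f (t : R) : Cb R :=
  ((t^-1)%:C : Rcomplex R) *: (S t f - f).

Definition generator_domain (S : R -> {linear Cb R -> Cb R}) : set (Cb R) :=
  [set f | (exists h, co_cvg (0 : R)^'+ (difference_quotient S f) h) /\
    exists M : R, forall t : R, 0 < t <= 1 -> sup_norm (S t f - f) / t <= M].

(* An operator is given by its domain [D] and a total function [A], whose values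
   outside [D] are irrelevant. *)
Definition is_generator (S : R -> {linear Cb R -> Cb R}) (D : set (Cb R))
    (A : Cb R -> Cb R) :=
  D = generator_domain S /\
  forall f, D f -> co_cvg (0 : R)^'+ (difference_quotient S f) (A f).

Definition generates_bi_continuous_semigroup (D : set (Cb R))
    (A : Cb R -> Cb R) :=
  exists S, bi_continuous_semigroup S /\ is_generator S D A.

End topologies_on_Cb.

Section complex_measures.
Variable R : realType.
Local Notation C := (Rcomplex R).
Local Notation borelR := (measurableTypeR R).

Record complex_measure := ComplexMeasure {
  cmeasure :> set borelR -> C ;
  cmeasure_sigma_additive : forall F : (set borelR)^nat,
    (forall n, measurable (F n)) -> trivIset setT F ->
    (\sum_(0 <= i < n) cmeasure (F i)) @[n --> \oo] -->
      cmeasure (\bigcup_n F n) }.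

Definition cmeasure_bounded (mu : complex_measure) :=
  exists M : R, forall A : set borelR, measurable A -> `|mu A| <= M.

(* Regularity of an additive set function; [mu] being small on all the Borel
   subsets of [U `\` K] amounts to [U `\` K] having small total variation. *)
Definition cmeasure_regular (mu : complex_measure) :=
  forall A : set borelR, measurable A -> forall e : R, 0 < e ->
    exists K U : set R, [/\ compact K, open U, K `<=` A, A `<=` U &
      forall B : set borelR, measurable B -> B `<=` U `\` K -> `|mu B| < e].

Lemma cmeasure0 (mu : complex_measure) : mu set0 = 0.
Proof.
set c := mu set0.
have sc : (\sum_(0 <= i < n) c)@[n --> \oo] --> c.
  have := @cmeasure_sigma_additive mu (fun=> set0) (fun=> measurable0).
  by rewrite bigcup0//; apply; exact: trivIset_set0.
have sc1 : (\sum_(0 <= i < n.+1) c)@[n --> \oo] --> c.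
  by rewrite (@cvg_shiftS C (fun n => \sum_(0 <= i < n) c) (nbhs c)).
have : (fun n => \sum_(0 <= i < n.+1) c - \sum_(0 <= i < n) c) @ \oo --> c - c.
  exact: cvgB.
under eq_fun do rewrite big_nat_recr//= addrAC subrr add0r.
rewrite subrr => c0; apply: (cvg_unique _ _ c0) => //; exact: cvg_cst.
Qed.

Section parts.
Variable mu : complex_measure.

Definition re_part (A : set borelR) : \bar R := (complex.Re (mu A))%:E.
Definition im_part (A : set borelR) : \bar R := (complex.Im (mu A))%:E.

Fact part_semi_sigma_additive (p : {linear C -> R}) :
  (forall z, `|p z| <= `|z|) ->
  semi_sigma_additive (fun A : set borelR => (p (mu A))%:E).
Proof.
move=> p1 F mF tF _.
have -> : (fun n => \sum_(0 <= i < n) (p (mu (F i)))%:E)%E =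
    (EFin \o (fun n => p (\sum_(0 <= i < n) mu (F i)))).
  by apply/funext => n /=; rewrite sumEFin (raddf_sum p).
apply: cvg_EFin; first by near=> n.
have /cvgrPdist_lt muF := @cmeasure_sigma_additive mu F mF tF.
apply/cvgrPdist_lt => e e0; apply: filterS (muF e e0) => n /=.
rewrite -(raddfB p); exact: le_lt_trans (p1 _).
Unshelve. all: by end_near. Qed.

Fact re_part0 : re_part set0 = 0%E. Proof. by rewrite /re_part cmeasure0. Qed.
Fact re_part_fin A : measurable A -> re_part A \is a fin_num. Proof. by []. Qed.
Fact re_part_sigma_additive : semi_sigma_additive re_part.
Proof. exact: (part_semi_sigma_additive (@Rcomplex_norm_Re R)). Qed.
HB.instance Definition _ := isCharge.Build _ borelR R re_part
  re_part0 re_part_fin re_part_sigma_additive.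

Fact im_part0 : im_part set0 = 0%E. Proof. by rewrite /im_part cmeasure0. Qed.
Fact im_part_fin A : measurable A -> im_part A \is a fin_num. Proof. by []. Qed.
Fact im_part_sigma_additive : semi_sigma_additive im_part.
Proof. exact: (part_semi_sigma_additive (@Rcomplex_norm_Im R)). Qed.
HB.instance Definition _ := isCharge.Build _ borelR R im_part
  im_part0 im_part_fin im_part_sigma_additive.

End parts.

Definition hahn_integral (nu : {charge set borelR -> \bar R}) (P N : set borelR)
    (nuPN : hahn_decomposition nu P N) (h : R -> R) : R :=
  \int[jordan_pos nuPN]_(x in [set: borelR]) h x -
  \int[jordan_neg nuPN]_(x in [set: borelR]) h x.

(* Integral against a finite signed measure through its Jordan decomposition,
   which does not depend on the Hahn decomposition that is chosen. *)
Definition charge_integral (nu : {charge set borelR -> \bar R}) : (R -> R) -> R :=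
  hahn_integral (projT2 (cid (projT2 (cid (Hahn_decomposition nu))))).

Definition cintegral (mu : complex_measure) (f : R -> C) : C :=
  (charge_integral (re_part mu) (fun x => complex.Re (f x)) -
   charge_integral (im_part mu) (fun x => complex.Im (f x))) +i*
  (charge_integral (re_part mu) (fun x => complex.Im (f x)) +
   charge_integral (im_part mu) (fun x => complex.Re (f x))).

End complex_measures.

Section distributions.
Variable R : realType.
Local Notation C := (Rcomplex R).

Record test_function := TestFunction {
  test_fun :> R -> C ;
  test_smooth : forall n x, derivable (derive1n n test_fun) x 1 ;
  test_support : compact (closure [set x | test_fun x != 0]) }.

Fact test_deriv_smooth (phi : test_function) n x :
  derivable (derive1n n (derive1 phi)) x 1.
Proof.
rewrite /derive1n -iterSr; exact: (@test_smooth phi n.+1).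
Qed.

Fact test_deriv_support (phi : test_function) :
  compact (closure [set x | derive1 phi x != 0]).
Proof.
apply: (subclosed_compact _ (@test_support phi)); first exact: closed_closure.
rewrite [X in X `<=` _]closureE; apply: smallest_sub; first exact: closed_closure.
move=> x /= fx0; apply: contrapT => nx; move/eqP: fx0; apply.
have phi0 : \near x, phi x = cst (0 : C) x.
  have : nbhs x (~` closure [set x | phi x != 0]).
    by apply: open_nbhs_nbhs; split => //; apply: closed_openC; exact: closed_closure.
  apply: filterS => y ny; apply/eqP; apply: contrapT => /negP y0; apply: ny.
  exact: subset_closure.
by rewrite derive1E (near_eq_derive _ phi0) derive_cst.
Qed.

Definition test_deriv (phi : test_function) : test_function :=
  TestFunction (@test_deriv_smooth phi) (@test_deriv_support phi).

Definition distribution := test_function -> C.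

Definition clebesgue_integral (f : R -> C) : C :=
  (\int[lebesgue_measure]_(x in [set: R]) complex.Re (f x)) +i*
  (\int[lebesgue_measure]_(x in [set: R]) complex.Im (f x)).

Definition distribution_of (f : R -> C) : distribution :=
  fun phi => clebesgue_integral (fun x => f x * phi x : C).

Definition distribution_deriv (T : distribution) : distribution :=
  fun phi => - T (test_deriv phi).

Definition X_m1 : set distribution :=
  [set T | exists f : Cb R,
    T = (fun phi => distribution_of f phi -
                    distribution_deriv (distribution_of f) phi)].

End distributions.

Section perturbed_derivative.
Variable R : realType.
Local Notation C := (Rcomplex R).

Definition discontinuities (g : R -> C) : set R :=
  [set x | ~ {for x, continuous g}].

Definition left_lim (g : R -> C) (x : R) : C := lim (g t @[t --> x^'-]).
Definition right_lim (g : R -> C) (x : R) : C := lim (g t @[t --> x^'+]).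

Definition jump_discontinuity (g : R -> C) (x : R) :=
  [/\ cvg (g t @[t --> x^'-]), cvg (g t @[t --> x^'+]) &
      left_lim g x <> right_lim g x].

Definition C1b_off (Z : set R) (f : R -> C) :=
  [/\ forall x, ~ Z x -> derivable f x 1,
      {within ~` Z, continuous (derive1 f)} &
      [bounded derive1 f x | x in ~` Z]].

Implicit Types (mu : complex_measure R) (g : R -> C).

Definition opC_domain mu g : set (Cb R) :=
  [set f : Cb R | C1b_off (discontinuities g) f /\
    forall x, discontinuities g x ->
      [/\ cvg (derive1 f t @[t --> x^'-]), cvg (derive1 f t @[t --> x^'+]) &
          left_lim (derive1 f) x - right_lim (derive1 f) x =
          cintegral mu f * (right_lim g x - left_lim g x) :> C]].

(* The continuous extension of [f' + Phi(f) g] from the complement of [Z] to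
   the line, which is unique as [Z] is discrete; [get] returns [0] if there is
   none. *)
Definition opC mu g (f : Cb R) : Cb R :=
  get [set h : Cb R | forall x, ~ discontinuities g x ->
    h x = derive1 f x + (cintegral mu f * g x : C)].

End perturbed_derivative.

(* Main.v *)
Require Import Defs.
From HB Require Import structures.
From mathcomp Require Import all_boot all_order all_algebra.
From mathcomp Require Import all_classical all_reals all_analysis.
From mathcomp Require Import complex.
From mathcomp Require Import measurable_realfun ring lra.

Set Implicit Arguments.
Unset Strict Implicit.
Unset Printing Implicit Defensive.

Import Order.TTheory GRing.Theory Num.Theory.
Import numFieldNormedType.Exports.

Local Open Scope classical_set_scope.
Local Open Scope ring_scope.

(** The unperturbed operator [f |-> f'] generates the left translations. The
    perturbing function [g] need not be continuous, but its integral over the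
    moving window from [x] to [x + t], against a continuous weight, is
    continuous in [x] and [t]. Variation of constants therefore stays inside
    the space:
    [S(t) f (x) = f (x + t) + int_x^(x+t) g(y) phi(x + t - y) dy], where
    [phi(t) = Phi (S(t) f)].
    Applying [Phi] gives an equation in which only the scalar function [phi] is
    unknown, of Volterra type. For the weighted norm [sup |phi(t)| exp(- w t)]
    with [w] large, the integral term is a contraction of factor one half
    ([Phi_conv_contraction]), so the equation is solvable ([volterra_exists])
    and its solutions are controlled by the data ([volterra_apriori]).
    Uniqueness yields the linearity of [S(t)] and, since translating a solution
    in time solves the equation for the evolved datum ([volterra_shift]), the
    semigroup law. The a priori bound yields the exponential estimate and,
    because [mu] has small variation outside large intervals
    ([cintegral_tight]), the bi-equicontinuity.

    For the generator, let [G] be an indefinite integral of [g] and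
    [u = f + Phi(f) G]. As [phi] is continuous with [phi(0) = Phi(f)], the
    difference [S(t) f - f] agrees with [u (. + t) - u] up to [o(t)], uniformly
    on the line ([evolution_first_order]). Hence the difference quotients of
    [S] at [f] converge locally uniformly to [h] exactly when [u] is
    differentiable everywhere with derivative [h] ([difference_quotient_cvg]).
    This is the condition that defines the domain of the operator: away from
    the discontinuities of [g] one has [G' = g], so [u' = f' + Phi(f) g], and
    the prescribed jumps of [f'] are those that cancel the jumps of
    [Phi(f) g], which makes the singularities of [u'] removable
    ([corrected_derivative], [corrected_derivative_domain]). The boundedness
    required in the domain of a generator then follows from the boundedness of
    [u']. *)

(** * Limits and continuity in epsilon-delta form *)

Section eps_delta.
Variable R : realType.

Lemma at_rightP (P : set R) (x : R) : (\forall y \near x^'+, P y) <->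
  exists2 d : R, 0 < d & forall y, x < y < x + d -> P y.
Proof.
split.
  move=> /nbhs_ballP[d /= d0 H]; exists d => // y /andP[xy yd].
  by apply: H => //=; rewrite /ball/= distrC gtr0_norm; lra.
move=> [d d0 H]; apply/nbhs_ballP; exists d => //= y.
rewrite /ball/= distrC => yd xy; apply: H; rewrite xy/=.
by move: yd; rewrite gtr0_norm; lra.
Qed.

Lemma at_leftP (P : set R) (x : R) : (\forall y \near x^'-, P y) <->
  exists2 d : R, 0 < d & forall y, x - d < y < x -> P y.
Proof.
split.
  move=> /nbhs_ballP[d /= d0 H]; exists d => // y /andP[xy yd].
  by apply: H => //=; rewrite /ball/= gtr0_norm; lra.
move=> [d d0 H]; apply/nbhs_ballP; exists d => //= y.
rewrite /ball/= => yd xy; apply: H; rewrite xy andbT.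
by move: yd; rewrite gtr0_norm; lra.
Qed.

Variable V : normedModType R.
Implicit Types f : R -> V.

Lemma continuous_atP f x : {for x, continuous f} <->
  forall e : R, 0 < e ->
    exists2 d : R, 0 < d & forall y, `|y - x| < d -> `|f y - f x| < e.
Proof.
split=> [/cvgrPdist_lt fx e /fx/nbhs_ballP[d /= d0 xd]|H].
  exists d => // y yx; rewrite distrC; apply: xd.
  by rewrite /ball/= distrC.
apply/cvgrPdist_lt => e /H[d d0 Hd]; apply/nbhs_ballP; exists d => //= y.
by rewrite /ball/= distrC => /Hd; rewrite distrC.
Qed.

Lemma continuous_locally_uniform f : continuous f -> forall A e : R, 0 < e ->
  exists2 d : R, 0 < d &
    forall x y, `|x| <= A -> `|y - x| < d -> `|f y - f x| <= e.
Proof.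
move=> cf A e e0.
have /compact_near_coveringP cK : compact `[- A, A] by exact: segment_compact.
pose P (d x : R) := forall y, `|y - x| < d -> `|f y - f x| <= e.
have : \forall d \near (0 : R)^'+, `[- A, A] `<=` P d.
  apply: cK => x _.
  have e2 : 0 < e / 2 by lra.
  have [d d0 Hd] := (continuous_atP f x).1 (cf x) _ e2.
  have d2 : 0 < d / 2 by lra.
  exists (ball x (d / 2), [set r : R | r < d / 2]) => /=.
    by split; [exact: nbhsx_ballx|exact: nbhs_right_lt].
  move=> [z r] /= [xz rd] y yz.
  have zx : `|z - x| < d / 2 by rewrite distrC.
  have h1 : `|f z - f x| < e / 2 by apply: Hd; lra.
  have h2 : `|f y - f x| < e / 2.
    apply: Hd; rewrite -(subrKA z) (le_lt_trans (ler_normD _ _))//; lra.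
  rewrite -(subrKA (f x)) (le_trans (ler_normD _ _))// (distrC (f x)); lra.
move=> /at_rightP[d d0 H]; exists (d / 2); first lra.
move=> x y xA yx; apply: (H (d / 2)) => //; first by lra.
by rewrite /= in_itv/= -ler_norml.
Qed.

Lemma continuous_locally_bounded f : continuous f -> forall A : R,
  exists2 M : R, 0 <= M & forall x, `|x| <= A -> `|f x| <= M.
Proof.
move=> cf A.
have /compact_bounded[M [_ HM]] : compact (f @` `[- A, A]).
  apply: continuous_compact; last exact: segment_compact.
  exact: continuous_subspaceT.
have Mlt : M < Num.max 0 (M + 1) by rewrite lt_max ltrDl ltr01 orbT.
exists (Num.max 0 (M + 1)) => [|x xA]; first by rewrite le_max lexx.
apply: (HM _ Mlt); exists x => //.
by rewrite /= in_itv/= -ler_norml.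
Qed.

End eps_delta.

(** * Integrals of locally bounded functions over oriented intervals *)

Section real_integral.
Variable R : realType.
Implicit Types (f k : R -> R) (a b c : R).
Local Notation leb := (@lebesgue_measure R).

(** The integrands that occur are products of [g] with continuous weights;
    this class contains them and is stable under products. *)
Definition loc_bounded_measurable f :=
  measurable_fun [set: R] f /\
  forall A : R, exists M : R, forall x, `|x| <= A -> `|f x| <= M.
Local Notation loc := loc_bounded_measurable.

Lemma loc_continuous f : continuous f -> loc f.
Proof.
move=> cf; split; first exact: continuous_measurable_fun.
by move=> A; have [M _ HM] := continuous_locally_bounded (V := R) cf A; exists M.
Qed.

Lemma locD f k : loc f -> loc k -> loc (fun x => f x + k x).
Proof.
move=> [mf bf] [mk bk]; split; first exact: measurable_funD.
move=> A; have [M HM] := bf A; have [N HN] := bk A.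
exists (M + N) => x xA; rewrite (le_trans (ler_normD _ _))//.
by apply: lerD; [exact: HM|exact: HN].
Qed.

Lemma locM f k : loc f -> loc k -> loc (fun x => f x * k x).
Proof.
move=> [mf bf] [mk bk]; split; first exact: measurable_funM.
move=> A; have [M HM] := bf A; have [N HN] := bk A.
by exists (M * N) => x xA; rewrite normrM ler_pM ?HM ?HN.
Qed.

Lemma loc_cst c : loc (fun=> c).
Proof. by apply: loc_continuous => x; exact: cvg_cst. Qed.

Lemma loc_integrable a b f : loc f -> leb.-integrable `]a, b] (EFin \o f).
Proof.
move=> [mf bf]; apply: measurable_bounded_integrable => //.
- rewrite /= lebesgue_measure_itv/=; case: ifPn => // _.
  by rewrite -EFinD ltry.
- exact: measurable_funTS.
- have [M HM] := bf (`|a| + `|b|); exists M; split; first exact: num_real.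
  move=> N MN x /=; rewrite in_itv/= => /andP[ax xb].
  apply: le_trans (ltW MN); apply: HM.
  have := ler_norm b; have := ler_norm (- a); rewrite normrN => ? ?.
  have := normr_ge0 a; have := normr_ge0 b => ? ?.
  by rewrite ler_norml; apply/andP; split; lra.
Qed.

(** Oriented: exchanging the bounds changes the sign, so that [rint_cat] holds
    without any order between the three points. *)
Definition rint a b f : R :=
  if a <= b then \int[leb]_(x in `]a, b]) f x else - \int[leb]_(x in `]b, a]) f x.

Lemma rintxx a f : rint a a f = 0.
Proof. by rewrite /rint lexx set_itvoc0 ?Rintegral_set0. Qed.

Lemma rint_sym a b f : rint b a f = - rint a b f.
Proof.
rewrite /rint; case: ltgtP => [||->]; rewrite ?opprK//.
by rewrite set_itvoc0 ?Rintegral_set0// oppr0.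
Qed.

Lemma rintD a b f k : loc f -> loc k ->
  rint a b (fun x => f x + k x) = rint a b f + rint a b k.
Proof.
move=> lf lk; rewrite /rint; case: ifP => _.
  by rewrite RintegralD//; exact: loc_integrable.
by rewrite RintegralD ?opprD//; exact: loc_integrable.
Qed.

Lemma rintZ a b f c : loc f -> rint a b (fun x => c * f x) = c * rint a b f.
Proof.
move=> lf; rewrite /rint; case: ifP => _.
  by rewrite RintegralZl//; exact: loc_integrable.
by rewrite RintegralZl ?mulrN//; exact: loc_integrable.
Qed.

Let rint_cat_le a b c f : loc f -> a <= b -> b <= c ->
  rint a c f = rint a b f + rint b c f.
Proof.
move=> lf ab bc; rewrite /rint ab bc (le_trans ab bc).
have E : `]a, c]%classic = `]a, b] `|` `]b, c] :> set R.
  by rewrite -itv_bndbnd_setU// bnd_simp.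
rewrite E Rintegral_setU//.
  by rewrite -E; exact: loc_integrable.
apply/disj_setPS => x /= [] /[!in_itv]/= /andP[_ xb] /andP[bx _].
by move: (lt_le_trans bx xb); rewrite ltxx.
Qed.

Lemma rint_cat a b c f : loc f -> rint a c f = rint a b f + rint b c f.
Proof.
move=> lf; have C x y z : x <= y -> y <= z -> rint x z f = rint x y f + rint y z f.
  exact: rint_cat_le.
case: (leP a b) => ab; case: (leP b c) => bc; case: (leP a c) => ac.
- by exact: C ab bc.
- by have := C _ _ _ ab bc; lra.
- have := C _ _ _ ac (ltW bc).
  rewrite (rint_sym b c); lra.
- have := C _ _ _ (ltW ac) ab.
  rewrite (rint_sym c b) (rint_sym a c); lra.
- have := C _ _ _ (ltW ab) ac.
  rewrite (rint_sym b a); lra.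
- have := C _ _ _ bc (ltW ac).
  rewrite (rint_sym b a) (rint_sym c a); lra.
- by move: (lt_trans bc ab) => /lt_geF; rewrite ac.
- have := C _ _ _ (ltW bc) (ltW ab).
  rewrite (rint_sym b a) (rint_sym c b) (rint_sym c a); lra.
Qed.

Lemma rint_le a b f k : loc f -> loc k -> a <= b ->
  (forall x, a < x <= b -> `|f x| <= k x) -> `|rint a b f| <= rint a b k.
Proof.
move=> lf lk ab fk; rewrite /rint ab.
rewrite (le_trans (le_normr_Rintegral _ _))//; first exact: loc_integrable.
apply: le_Rintegral => //.
- have := @loc_integrable a b (fun x => `|f x|); apply.
  case: lf => mf bf; split; first exact: measurableT_comp.
  by move=> A; have [M HM] := bf A; exists M => x /HM; rewrite normr_id.
- exact: loc_integrable.
Qed.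

Lemma rint_cst a b c : rint a b (fun=> c) = c * (b - a).
Proof.
rewrite /rint; case: leP => ab.
  rewrite Rintegral_cst//= lebesgue_measure_itv/= lte_fin.
  move: ab; rewrite le_eqVlt => /orP[/eqP->|->/=//]; rewrite ltxx/=; lra.
rewrite Rintegral_cst//= lebesgue_measure_itv/= lte_fin ab/=; lra.
Qed.

(** This integral is where the factor [1 / w] comes from that makes the
    Volterra operator contract in the weighted norm. *)
Lemma rint_exp a b c w : a <= b -> 0 < w ->
  rint a b (fun y => c * expR (w * (b - y))) <= `|c| / w * expR (w * (b - a)).
Proof.
move=> ab w0.
pose F y : R := - (c / w) * expR (w * (b - y)).
have dF (y : R) : is_derive y 1 F (c * expR (w * (b - y))).
  have -> : c * expR (w * (b - y)) =
      - (c / w) *: (expR (w * (b - y)) * (w *: (0 - 1))).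
    rewrite /GRing.scale/=; field; lra.
  apply: is_deriveZ; exact: (@is_derive1_comp _ expR (fun y => w * (b - y))).
have cexp : continuous (fun y => c * expR (w * (b - y))).
  move=> y; apply: cvgM; first exact: cvg_cst.
  apply: (@cvg_comp _ _ _ (fun y => w * (b - y)) expR).
    apply: cvgM; first exact: cvg_cst.
    by apply: cvgB; [exact: cvg_cst|exact: cvg_id].
  exact: continuous_expR.
have cF : continuous F.
  by move=> y; apply: differentiable_continuous; apply/derivable1_diffP; case: (dF y).
have -> : rint a b (fun y => c * expR (w * (b - y))) = F b - F a.
  rewrite /rint ab; move: ab; rewrite le_eqVlt => /orP[/eqP<-|ltab].
    by rewrite set_itvoc0 ?Rintegral_set0 ?subrr.
  rewrite Rintegral_itv_obnd_cbnd; last first.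
    exact: loc_integrable (loc_continuous cexp).
  rewrite /Rintegral (@continuous_FTC2 _ _ F)//.
  - exact: continuous_subspaceT cexp.
  - split => //.
    + exact/cvg_at_right_filter/cF.
    + exact/cvg_at_left_filter/cF.
  - by move=> y _; rewrite derive1E; exact: derive_val.
rewrite /F subrr mulr0 expR0.
have E1 : 0 <= w^-1 by rewrite invr_ge0; lra.
have e1 : 1 <= expR (w * (b - a)).
  have : 0 <= w * (b - a) by apply: mulr_ge0; lra.
  by rewrite -expR0 ler_expR.
set E := expR _ in e1 *.
have h1 : 0 <= (`|c| - c) * w^-1 * (E - 1).
  by rewrite !mulr_ge0// subr_ge0// ler_norm.
have h2 : 0 <= `|c| * w^-1 by rewrite mulr_ge0.
nra.
Qed.

End real_integral.

(** * Complex-valued integrals *)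

Section complex_integral.
Variable R : realType.
Local Notation C := (Rcomplex R).
Implicit Types (f k : R -> C) (a b c : R).

Lemma norm_le_ReIm (z : C) : `|z| <= `|complex.Re z| + `|complex.Im z|.
Proof.
case: z => x y; rewrite [leLHS]/Num.norm/=.
rewrite -(@ler_pXn2r _ 2)// ?nnegrE ?sqrtr_ge0 ?addr_ge0//.
rewrite sqr_sqrtr ?addr_ge0 ?sqr_ge0// sqrrD !real_normK ?num_real//.
have : 0 <= `|x| * `|y| by rewrite mulr_ge0.
rewrite mulr2n; lra.
Qed.

Definition loc_bounded_measurableC f :=
  loc_bounded_measurable (fun x => complex.Re (f x)) /\
  loc_bounded_measurable (fun x => complex.Im (f x)).
Local Notation cloc := loc_bounded_measurableC.

Lemma continuous_Re f : continuous f -> continuous (fun x => complex.Re (f x)).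
Proof.
move=> cf x; apply/continuous_atP => e e0.
have [d d0 Hd] := (continuous_atP f x).1 (cf x) e e0.
exists d => // y /Hd; apply: le_lt_trans.
by rewrite -raddfB; exact: Rcomplex_norm_Re.
Qed.

Lemma continuous_Im f : continuous f -> continuous (fun x => complex.Im (f x)).
Proof.
move=> cf x; apply/continuous_atP => e e0.
have [d d0 Hd] := (continuous_atP f x).1 (cf x) e e0.
exists d => // y /Hd; apply: le_lt_trans.
by rewrite -raddfB; exact: Rcomplex_norm_Im.
Qed.

Lemma cloc_continuous f : continuous f -> cloc f.
Proof.
by move=> cf; split; apply: loc_continuous; [exact: continuous_Re|exact: continuous_Im].
Qed.

Lemma clocD f k : cloc f -> cloc k -> cloc (fun x => f x + k x).
Proof.
move=> [f1 f2] [k1 k2]; split.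
  by under eq_fun do rewrite raddfD; exact: locD.
by under eq_fun do rewrite raddfD; exact: locD.
Qed.

Let ReM (z w : C) : complex.Re (z * w : C) =
  complex.Re z * complex.Re w + (-1) * (complex.Im z * complex.Im w).
Proof. by case: z => a b; case: w => c d /=; rewrite mulN1r. Qed.

Let ImM (z w : C) : complex.Im (z * w : C) =
  complex.Re z * complex.Im w + complex.Im z * complex.Re w.
Proof. by case: z => a b; case: w => c d /=. Qed.

Lemma clocM f k : cloc f -> cloc k -> cloc (fun x => f x * k x).
Proof.
move=> [f1 f2] [k1 k2]; split.
  under eq_fun do rewrite ReM.
  apply: locD; first exact: locM.
  by apply: locM; [exact: loc_cst|exact: locM].
by under eq_fun do rewrite ImM; apply: locD; exact: locM.
Qed.

Lemma cloc_cst (c : C) : cloc (fun=> c).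
Proof. by split; exact: loc_cst. Qed.

Definition cint a b f : C :=
  (rint a b (fun x => complex.Re (f x)) +i* rint a b (fun x => complex.Im (f x)))%C.

Lemma cintxx a f : cint a a f = 0.
Proof. by rewrite /cint !rintxx. Qed.

Lemma cintD a b f k : cloc f -> cloc k ->
  cint a b (fun x => f x + k x) = cint a b f + cint a b k.
Proof.
move=> [f1 f2] [k1 k2]; rewrite /cint.
under eq_fun do rewrite raddfD.
under [X in (_ +i* rint a b X)%C]eq_fun do rewrite raddfD.
by rewrite !rintD.
Qed.

Lemma cintZ a b (c : C) f : cloc f -> cint a b (fun x => c * f x) = c * cint a b f.
Proof.
move=> [f1 f2]; rewrite /cint.
under eq_fun do rewrite ReM.
under [X in (_ +i* rint a b X)%C]eq_fun do rewrite ImM.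
have L (u : R) (v : R -> R) : loc_bounded_measurable v -> loc_bounded_measurable (fun x => u * v x).
  by move=> lv; apply: locM => //; exact: loc_cst.
have [L1 L2] := (L (complex.Re c) _ f1, L (complex.Im c) _ f2).
have [L3 L4] := (L (complex.Re c) _ f2, L (complex.Im c) _ f1).
rewrite (rintD _ _ L1 (L (-1) _ L2)) (rintD _ _ L3 L4).
rewrite (rintZ _ _ (-1) L2) !rintZ//.
by clear; case: c => x y; rewrite mulN1r.
Qed.

Lemma cintB a b f k : cloc f -> cloc k ->
  cint a b (fun x => f x - k x) = cint a b f - cint a b k.
Proof.
move=> lf lk; under eq_fun do rewrite -mulN1r.
rewrite cintD ?cintZ ?mulN1r//; apply: clocM => //; exact: cloc_cst.
Qed.

Lemma cint_cat a b c f : cloc f -> cint a c f = cint a b f + cint b c f.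
Proof. by move=> [f1 f2]; rewrite /cint (rint_cat a b c f1) (rint_cat a b c f2). Qed.

Lemma cint_sym a b f : cint b a f = - cint a b f.
Proof. by rewrite /cint rint_sym (rint_sym a b (fun x => complex.Im (f x))). Qed.

(** The factor 2 is the price of estimating real and imaginary parts
    separately. *)
Lemma cint_le a b f (k : R -> R) : cloc f -> loc_bounded_measurable k -> a <= b ->
  (forall x, a < x <= b -> `|f x| <= k x) -> `|cint a b f| <= 2 * rint a b k.
Proof.
move=> [f1 f2] lk ab fk; rewrite (le_trans (norm_le_ReIm _))//= mulr_natl mulr2n.
by apply: lerD; apply: rint_le => // x /fk; apply: le_trans;
  [exact: Rcomplex_norm_Re|exact: Rcomplex_norm_Im].
Qed.

Lemma cint_le_cst a b f (M : R) : cloc f ->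
  (forall x, Num.min a b <= x <= Num.max a b -> `|f x| <= M) ->
  `|cint a b f| <= 2 * M * `|b - a|.
Proof.
move=> lf; wlog ab : a b / a <= b => [H|].
  case: (leP a b) => [|/ltW] ab; first by have := H a b ab; rewrite min_l ?max_r.
  by have := H b a ab; rewrite min_l ?max_r// distrC cint_sym normrN.
rewrite min_l// max_r// => HM.
rewrite (le_trans (cint_le lf (loc_cst M) ab _))//.
  by move=> x /andP[ax xb]; rewrite HM// (ltW ax).
by rewrite rint_cst ger0_norm ?mulrA// subr_ge0.
Qed.

End complex_integral.
(** * The functional given by the measure *)

Section finite_measure_integral.
Variable R : realType.
Local Notation borelR := (measurableTypeR R).
Variable nu : {finite_measure set borelR -> \bar R}.
Implicit Types h k : R -> R.

Lemma finite_measure_integrable h : continuous h ->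
  (exists M : R, forall x, `|h x| <= M) ->
  nu.-integrable [set: borelR] (EFin \o h).
Proof.
move=> ch [M HM]; apply: measurable_bounded_integrable => //.
- by rewrite ltey_eq fin_num_measure.
- exact: continuous_measurable_fun.
- exists M; split; first exact: num_real.
  by move=> N MN x _; exact: le_trans (HM x) (ltW MN).
Qed.

Let off (A : R) : set borelR := ~` `[- A, A].

Let moff A : measurable (off A).
Proof. by apply: measurableC; exact: measurable_itv. Qed.

(** Continuity from above along the complements of [[-n, n]], whose intersection
    is empty. *)
Lemma finite_measure_tight (e : R) : 0 < e ->
  exists A : R, fine (nu (~` `[- A, A])) <= e.
Proof.
move=> e0.
have : (nu \o (fun n => off n%:R)) n @[n --> \oo] --> nu (\bigcap_n off n%:R).
  apply: nonincreasing_cvg_mu => //.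
  - by rewrite ltey_eq fin_num_measure.
  - exact: bigcap_measurableType.
  - move=> n m nm; apply/subsetPset; apply: subsetC => x /=.
    rewrite !in_itv/= -!ler_norml => /le_trans; apply.
    by rewrite ler_nat.
have -> : \bigcap_n off n%:R = set0.
  apply/seteqP; split=> // x H.
  have /(_ I) := H (Num.truncn `|x|).+1.
  rewrite /off/= in_itv/= -ler_norml; apply.
  by rewrite ltW// truncnS_gt.
rewrite measure0 => /fine_cvgP[_ /cvgrPdist_le/(_ e e0)[N _ HN]].
exists N%:R; have := HN N (leqnn N); rewrite /= sub0r normrN.
by apply: le_trans; exact: ler_norm.
Qed.

Lemma finite_measure_integral_bound (A a b : R) h : continuous h ->
  (forall x, `|x| <= A -> `|h x| <= a) -> (forall x, `|h x| <= b) ->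
  `|\int[nu]_(x in [set: borelR]) h x| <=
    `|a| * fine (nu [set: borelR]) + b * fine (nu (~` `[- A, A])).
Proof.
move=> ch ha hb.
have ih := finite_measure_integrable ch (ex_intro _ b hb).
rewrite (le_trans (le_normr_Rintegral _ ih))//.
have cnh : continuous (fun x => `|h x|).
  by move=> x; apply: cvg_norm; exact: ch.
have inh : nu.-integrable [set: borelR] (EFin \o (fun x => `|h x|)).
  by apply: finite_measure_integrable => //; exists b => x; rewrite normr_id.
have mI : measurable (`[- A, A] : set borelR) by exact: measurable_itv.
have E : [set: borelR] = `[- A, A] `|` off A by rewrite setUv.
have cst_int c (D : set borelR) : measurable D -> nu.-integrable D (EFin \o (fun=> c)).
  move=> mD; apply: (@integrableS _ _ _ nu [set: borelR]) => //.
  apply: (@finite_measure_integrable (fun=> c)); first by move=> x; exact: cvg_cst.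
  by exists `|c|.
rewrite [X in \int[_]_(_ in X) _ <= _]E Rintegral_setU//; first last.
- by apply/disj_setPS; rewrite /off setICr.
- by rewrite -E.
apply: lerD.
  apply: (@le_trans _ _ (\int[nu]_(x in (`[- A, A] : set borelR)) `|a|)).
    apply: le_Rintegral => //; first exact: integrableS inh.
    - exact: cst_int.
    - move=> x; rewrite /= in_itv/= -ler_norml => /ha/le_trans; apply.
      exact: ler_norm.
  rewrite Rintegral_cst// ler_wpM2l//.
  apply: fine_le; rewrite ?fin_num_measure//.
  by apply: le_measure; rewrite ?inE.
apply: (@le_trans _ _ (\int[nu]_(x in off A) b)).
  apply: le_Rintegral => //; first exact: integrableS inh.
  exact: cst_int.
by rewrite Rintegral_cst.
Qed.

End finite_measure_integral.

(** Continuity along bounded sequences that converge locally uniformly, in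
    quantitative form: the values on a fixed bounded interval enter with a fixed
    constant, those outside it with an arbitrarily small one. *)
Definition tight_functional (R : realType) (Phi : Cb R -> Rcomplex R) (M : R) :=
  forall e : R, 0 < e -> exists A : R, forall (f : Cb R) (a b : R),
    0 <= a -> 0 <= b ->
    (forall x, `|x| <= A -> `|f x| <= a) -> (forall x, `|f x| <= b) ->
    `|Phi f| <= M * a + e * b.

Section functional.
Variables (R : realType).
Local Notation C := (Rcomplex R).
Local Notation borelR := (measurableTypeR R).

(** Hides the choice of a Hahn decomposition. *)
Lemma charge_integralE (nu : {charge set borelR -> \bar R}) :
  exists nu1 nu2 : {finite_measure set borelR -> \bar R},
    forall h, charge_integral nu h =
      \int[nu1]_(x in [set: borelR]) h x - \int[nu2]_(x in [set: borelR]) h x.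
Proof.
pose H := projT2 (cid (projT2 (cid (Hahn_decomposition nu)))).
by exists (jordan_pos H), (jordan_neg H).
Qed.

Let bcont (h : R -> R) := continuous h /\ exists M : R, forall x, `|h x| <= M.

Lemma charge_integralD (nu : {charge set borelR -> \bar R}) h k :
  bcont h -> bcont k ->
  charge_integral nu (fun x => h x + k x) =
  charge_integral nu h + charge_integral nu k.
Proof.
move=> [ch bh] [ck bk]; have [n1 [n2 E]] := charge_integralE nu.
by rewrite !E !RintegralD//; do ?exact: finite_measure_integrable; lra.
Qed.

Lemma charge_integralZ (nu : {charge set borelR -> \bar R}) (c : R) h :
  bcont h ->
  charge_integral nu (fun x => c * h x) = c * charge_integral nu h.
Proof.
move=> [ch bh]; have [n1 [n2 E]] := charge_integralE nu.
by rewrite !E !RintegralZl//; do ?exact: finite_measure_integrable; lra.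
Qed.

Lemma charge_integral_tight (nu : {charge set borelR -> \bar R}) :
  exists2 M : R, 0 <= M & forall e : R, 0 < e -> exists A : R,
    forall h a b, continuous h -> 0 <= a -> 0 <= b ->
      (forall x, `|x| <= A -> `|h x| <= a) -> (forall x, `|h x| <= b) ->
      `|charge_integral nu h| <= M * a + e * b.
Proof.
have [n1 [n2 E]] := charge_integralE nu.
exists (fine (n1 [set: borelR]) + fine (n2 [set: borelR])).
  by rewrite addr_ge0// fine_ge0.
move=> e e0; have e2 : 0 < e / 2 by lra.
have [A1 H1] := finite_measure_tight n1 e2.
have [A2 H2] := finite_measure_tight n2 e2.
exists (Num.max A1 A2) => h a b ch a0 b0 ha hb; rewrite E.
rewrite (le_trans (ler_normB _ _))//.
have -> : (fine (n1 setT) + fine (n2 setT)) * a + e * b =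
  (a * fine (n1 setT) + b * (e / 2)) + (a * fine (n2 setT) + b * (e / 2)).
  by field.
apply: lerD.
- apply: (le_trans (finite_measure_integral_bound n1 (A := A1) ch _ hb)).
    by move=> x xA; apply: ha; rewrite le_max xA.
  by rewrite ger0_norm// lerD2l ler_wpM2l.
- apply: (le_trans (finite_measure_integral_bound n2 (A := A2) ch _ hb)).
    by move=> x xA; apply: ha; rewrite le_max xA orbT.
  by rewrite ger0_norm// lerD2l ler_wpM2l.
Qed.

Variable mu : complex_measure R.
Local Notation Phi := (cintegral mu).

Let bcont_Re (f : Cb R) : bcont (fun x => complex.Re (f x)).
Proof.
split; first by apply: continuous_Re; exact: Cb_continuous.
have [M HM] := Cb_bounded f; exists M => x.
exact: le_trans (Rcomplex_norm_Re _) (HM x).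
Qed.

Let bcont_Im (f : Cb R) : bcont (fun x => complex.Im (f x)).
Proof.
split; first by apply: continuous_Im; exact: Cb_continuous.
have [M HM] := Cb_bounded f; exists M => x.
exact: le_trans (Rcomplex_norm_Im _) (HM x).
Qed.

Lemma cintegralD (f k : Cb R) : Phi (f + k : Cb R) = Phi f + Phi k :> C.
Proof.
rewrite /cintegral.
have -> : (fun x => complex.Re ((f + k : Cb R) x)) =
  (fun x => complex.Re (f x) + complex.Re (k x)).
  by apply/funext => x; rewrite -raddfD.
have -> : (fun x => complex.Im ((f + k : Cb R) x)) =
  (fun x => complex.Im (f x) + complex.Im (k x)).
  by apply/funext => x; rewrite -raddfD.
rewrite !charge_integralD//.
by apply/eqP; rewrite eq_complex /=; apply/andP; split; apply/eqP; ring.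
Qed.

Lemma cintegralZ (c : C) (f : Cb R) : Phi (c *: f : Cb R) = c * Phi f :> C.
Proof.
rewrite /cintegral; case: c => u v.
have -> : (fun x => complex.Re (((u +i* v)%C *: f : Cb R) x)) =
  (fun x => u * complex.Re (f x) + (- v) * complex.Im (f x)).
  by apply/funext => x /=; case: (f x) => p q /=; rewrite mulNr.
have -> : (fun x => complex.Im (((u +i* v)%C *: f : Cb R) x)) =
  (fun x => u * complex.Im (f x) + v * complex.Re (f x)).
  by apply/funext => x /=; case: (f x) => p q /=.
have bZ w h : bcont h -> bcont (fun x => w * h x).
  move=> [ch [M HM]]; split.
    by move=> x; apply: cvgM; [exact: cvg_cst|exact: ch].
  by exists (`|w| * M) => x; rewrite normrM ler_wpM2l.
rewrite !charge_integralD ?charge_integralZ//; do ?exact: bZ.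
by apply/eqP; rewrite eq_complex /=; apply/andP; split; apply/eqP; ring.
Qed.

Lemma cintegral_tight :
  exists2 M : R, 0 <= M & tight_functional (fun f : Cb R => Phi f) M.
Proof.
have [M1 M10 H1] := charge_integral_tight (re_part mu).
have [M2 M20 H2] := charge_integral_tight (im_part mu).
exists (2 * M1 + 2 * M2); first by rewrite addr_ge0 ?mulr_ge0.
move=> e e0; have e4 : 0 < e / 4 by lra.
have [A1 {}H1] := H1 _ e4; have [A2 {}H2] := H2 _ e4.
exists (Num.max A1 A2) => f a b a0 b0 ha hb.
have hRe A : A <= Num.max A1 A2 -> forall x, `|x| <= A -> `|complex.Re (f x)| <= a.
  move=> AA x xA; apply: le_trans (Rcomplex_norm_Re _) _.
  by apply: ha; exact: le_trans AA.
have hIm A : A <= Num.max A1 A2 -> forall x, `|x| <= A -> `|complex.Im (f x)| <= a.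
  move=> AA x xA; apply: le_trans (Rcomplex_norm_Im _) _.
  by apply: ha; exact: le_trans AA.
have A1m : A1 <= Num.max A1 A2 by rewrite le_max lexx.
have A2m : A2 <= Num.max A1 A2 by rewrite le_max lexx orbT.
have hRe' x : `|complex.Re (f x)| <= b by exact: le_trans (Rcomplex_norm_Re _) _.
have hIm' x : `|complex.Im (f x)| <= b by exact: le_trans (Rcomplex_norm_Im _) _.
rewrite (le_trans (norm_le_ReIm _))//=.
have R1 := H1 _ a b (bcont_Re f).1 a0 b0 (hRe _ A1m) hRe'.
have R2 := H1 _ a b (bcont_Im f).1 a0 b0 (hIm _ A1m) hIm'.
have R3 := H2 _ a b (bcont_Re f).1 a0 b0 (hRe _ A2m) hRe'.
have R4 := H2 _ a b (bcont_Im f).1 a0 b0 (hIm _ A2m) hIm'.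
move: (charge_integral (re_part mu) _) (charge_integral (re_part mu) _)
  (charge_integral (im_part mu) _) (charge_integral (im_part mu) _)
  R1 R2 R3 R4 => p1 p2 p3 p4; clear => R1 R2 R3 R4.
have T1 := ler_normB p2 p3; have T2 := ler_normD p1 p4; lra.
Qed.

End functional.
(** * Convolution with the perturbing function *)

Section convolution.
Variable R : realType.
Local Notation C := (Rcomplex R).
Variables (g : R -> C) (N : R).
Hypothesis gN : forall x, `|g x| <= N.
Hypothesis lg : loc_bounded_measurableC g.
Implicit Types phi psi : R -> C.

Let N0 : 0 <= N.
Proof. exact: le_trans (normr_ge0 _) (gN 0). Qed.

(** The substitution [y = x + t - s] in the convolution integral over
    [0 <= s <= t] of [g (x + t - s) phi(s)]. In this form it is the weight that
    moves and not [g], so continuity in [x] and [t] reduces to that of [phi]. *)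
Definition gconv phi (t x : R) : C :=
  cint x (x + t) (fun y => g y * phi (x + t - y) : C).

Lemma continuous_reflect phi b : continuous phi -> continuous (fun y => phi (b - y)).
Proof.
move=> cphi y; apply: (@cvg_comp _ _ _ (fun y => b - y) phi); last exact: cphi.
by apply: cvgB; [exact: cvg_cst|exact: cvg_id].
Qed.

Lemma gconv_integrand phi b : continuous phi ->
  loc_bounded_measurableC (fun y => g y * phi (b - y) : C).
Proof.
move=> cphi; apply: clocM => //; apply: cloc_continuous.
exact: continuous_reflect.
Qed.

Lemma gconvD phi psi t x : continuous phi -> continuous psi ->
  gconv (fun r => phi r + psi r) t x = gconv phi t x + gconv psi t x.
Proof.
move=> cphi cpsi; rewrite /gconv -cintD; do ?exact: gconv_integrand.
by congr cint; apply/funext => y; rewrite mulrDr.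
Qed.

Lemma gconvZ (c : C) phi t x : continuous phi ->
  gconv (fun r => c * phi r) t x = c * gconv phi t x.
Proof.
move=> cphi; rewrite /gconv -cintZ; last exact: gconv_integrand.
by congr cint; apply/funext => y; rewrite mulrCA.
Qed.

(** The cocycle identity behind the semigroup law: cut the window of length
    [t + s] at [x + t]. *)
Lemma gconv_cat phi t s x : continuous phi ->
  gconv phi (t + s) x = gconv phi s (x + t) + gconv (fun r => phi (r + s)) t x.
Proof.
move=> cphi; rewrite /gconv (@cint_cat _ x (x + t)); last exact: gconv_integrand.
rewrite addrC addrA; congr (_ + _); congr cint; apply/funext => y.
by congr (_ * phi _); ring.
Qed.

Lemma gconv_exp_le phi (t x L w : R) : continuous phi -> 0 <= t -> 0 < w ->
  (forall r, 0 <= r <= t -> `|phi r| <= L * expR (w * r)) ->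
  `|gconv phi t x| <= 2 * (N * L / w) * expR (w * t).
Proof.
move=> cphi t0 w0 phiL.
have L0 : 0 <= L.
  have /phiL : 0 <= (0 : R) <= t by rewrite lexx.
  by rewrite mulr0 expR0 mulr1; exact: le_trans.
have xt : x <= x + t by rewrite lerDl.
pose k y := N * L * expR (w * (x + t - y)).
have ck : continuous k.
  move=> y; apply: cvgM; first exact: cvg_cst.
  apply: (@cvg_comp _ _ _ (fun y => w * (x + t - y)) expR).
    apply: cvgM; first exact: cvg_cst.
    by apply: cvgB; [exact: cvg_cst|exact: cvg_id].
  exact: continuous_expR.
have lk : loc_bounded_measurable k by exact: loc_continuous.
rewrite (le_trans (cint_le (gconv_integrand _ cphi) lk xt _))//.
  move=> y /andP[xy yt]; rewrite Rcomplex_normM /k -mulrA ler_pM//.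
  by apply: phiL; apply/andP; split; lra.
rewrite -mulrA ler_wpM2l//.
rewrite (le_trans (rint_exp _ xt w0))// ger0_norm ?mulr_ge0//.
by rewrite (addrC x) addrK.
Qed.

Lemma gconv_le phi (t x L : R) : continuous phi ->
  (forall r, Num.min 0 t <= r <= Num.max 0 t -> `|phi r| <= L) ->
  `|gconv phi t x| <= 2 * (N * L) * `|t|.
Proof.
move=> cphi phiL; rewrite /gconv.
have -> : `|t| = `|x + t - x| by rewrite (addrC x) addrK.
apply: cint_le_cst; first exact: gconv_integrand.
move=> y H; rewrite Rcomplex_normM ler_pM//; apply: phiL.
move: H; case: (leP 0 t) => t0; [rewrite min_l ?max_r|rewrite min_r ?max_l]; try lra.
Qed.

Lemma norm_le_between (t r : R) : Num.min 0 t <= r <= Num.max 0 t -> `|r| <= `|t|.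
Proof.
by case: (leP 0 t) => t0 /andP[? ?]; [rewrite !ger0_norm|rewrite !ler0_norm]; lra.
Qed.

(** Moving the window changes the integral over two short intervals, on which
    the integrand is bounded, and changes the weight on the common part, where
    the uniform continuity of [phi] applies. *)
Lemma gconv_locally_uniform phi : continuous phi -> forall A e : R, 0 < e ->
  exists2 d : R, 0 < d & forall t t' x x' : R, `|t| <= A -> `|x| <= A ->
    `|t' - t| < d -> `|x' - x| < d -> `|gconv phi t' x' - gconv phi t x| <= e.
Proof.
move=> cphi A e e0.
pose B : R := 2 * `|A| + 2.
have B0 : 0 <= B by rewrite /B addr_ge0// mulr_ge0.
have [m m0 phim] := continuous_locally_bounded cphi (2 * B).
pose K : R := 2 * N * `|A| + 1.
have K0 : 0 < K by rewrite /K ltr_wpDl// !mulr_ge0.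
have e1 : 0 < e / 2 / K by rewrite divr_gt0//; lra.
have [d1 d10 phid] := continuous_locally_uniform cphi (2 * B) e1.
pose d2 := e / 2 / (6 * (N * m) + 1).
have d20 : 0 < d2.
  by rewrite /d2 divr_gt0//; [lra|rewrite ltr_wpDl// !mulr_ge0].
pose d := Num.min (d1 / 2) (Num.min d2 1).
have dd1 : d <= d1 / 2 by rewrite /d ge_min lexx.
have dd2 : d <= d2 by rewrite /d !ge_min lexx orbT.
have dd3 : d <= 1 by rewrite /d !ge_min lexx !orbT.
exists d; first by rewrite /d !lt_min d20 ltr01 andbT; lra.
move=> t t' x x' tA xA tt' xx'.
have AA : A <= `|A| := ler_norm A.
have A0 : 0 <= `|A| by [].
have xt : `|x + t| <= 2 * `|A| by rewrite (le_trans (ler_normD _ _))//; lra.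
have x'A : `|x'| <= `|A| + 1.
  by rewrite -(subrK x x') (le_trans (ler_normD _ _))//; lra.
have dist : `|(x' + t') - (x + t)| < 2 * d.
  have -> : (x' + t') - (x + t) = (x' - x) + (t' - t) by ring.
  by rewrite (le_lt_trans (ler_normD _ _))//; lra.
have x't' : `|x' + t'| <= B.
  rewrite -(subrK (x + t) (x' + t')) (le_trans (ler_normD _ _))// /B; lra.
rewrite /gconv.
set F' := fun y => g y * phi (x' + t' - y) : C.
set F := fun y => g y * phi (x + t - y) : C.
have lF' : loc_bounded_measurableC F' by exact: gconv_integrand.
have lF : loc_bounded_measurableC F by exact: gconv_integrand.
rewrite (cint_cat x' x (x' + t') lF') (cint_cat x (x + t) (x' + t') lF').
have F'm y : `|y| <= B -> `|F' y| <= N * m.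
  move=> yB; rewrite /F' Rcomplex_normM ler_pM//; apply: phim.
  by rewrite (le_trans (ler_normB _ _))//; lra.
have btw a b y : `|a| <= B -> `|b| <= B -> Num.min a b <= y <= Num.max a b -> `|y| <= B.
  rewrite !ler_norml; case: (leP a b) => _ /andP[? ?] /andP[? ?] /andP[? ?];
  by apply/andP; split; lra.
have I1 : `|cint x' x F'| <= 2 * (N * m) * d.
  apply: (le_trans (cint_le_cst (M := N * m) lF' _)).
    by move=> y /btw yB; apply: F'm; apply: yB; rewrite /B; lra.
  by rewrite distrC ler_wpM2l ?(ltW xx')// !mulr_ge0.
have I2 : `|cint (x + t) (x' + t') F'| <= 2 * (N * m) * (2 * d).
  apply: (le_trans (cint_le_cst (M := N * m) lF' _)).
    by move=> y /btw yB; apply: F'm; apply: yB => //; rewrite /B; lra.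
  by rewrite ler_wpM2l ?(ltW dist)// !mulr_ge0.
have I3 : `|cint x (x + t) F' - cint x (x + t) F| <= 2 * (N * (e / 2 / K)) * `|A|.
  rewrite -cintB//.
  apply: (le_trans (cint_le_cst (M := N * (e / 2 / K)) _ _)).
  - under eq_fun do rewrite -mulN1r.
    by apply: clocD => //; apply: clocM => //; exact: cloc_cst.
  - move=> y /btw yB; rewrite /F' /F -mulrBr Rcomplex_normM ler_pM//.
    have {}yB : `|y| <= B by apply: yB; rewrite /B; lra.
    apply: phid; first by apply: (le_trans (ler_normB _ _)); rewrite /B in yB *; lra.
    have -> : x' + t' - y - (x + t - y) = (x' + t') - (x + t) by ring.
    lra.
  - have tA' : `|x + t - x| <= `|A| by rewrite (addrC x) addrK; lra.
    by rewrite ler_wpM2l// mulr_ge0// mulr_ge0// ltW.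
have J1 : 6 * (N * m) * d <= e / 2.
  apply: (@le_trans _ _ ((6 * (N * m) + 1) * d2)).
    by apply: ler_pM => //; rewrite ?mulr_ge0//; [rewrite /d !le_min; lra|lra].
  by rewrite /d2 mulrC divfK// gt_eqF// ltr_wpDl// !mulr_ge0.
have J2 : 2 * (N * (e / 2 / K)) * `|A| <= e / 2.
  have -> : 2 * (N * (e / 2 / K)) * `|A| = (2 * N * `|A|) * (e / 2 / K) by ring.
  apply: (@le_trans _ _ (K * (e / 2 / K))); first by rewrite ler_wpM2r// ?(ltW e1)// /K; lra.
  by rewrite mulrC divfK// gt_eqF.
have -> : cint x' x F' + (cint x (x + t) F' + cint (x + t) (x' + t') F')
    - cint x (x + t) F =
    cint x' x F' + (cint x (x + t) F' - cint x (x + t) F)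
    + cint (x + t) (x' + t') F' :> C.
  by rewrite !addrA (addrAC (cint x' x F' + cint x (x + t) F')).
rewrite (le_trans (ler_normD _ _))//.
rewrite (le_trans (lerD (ler_normD _ _) (lexx _)))//; lra.
Qed.

Fact conv_Cb_subproof phi (cphi : continuous phi) t :
  (gconv phi t : R -> C) \in @Cb_pred R.
Proof.
apply/mem_set; split.
  move=> x; apply/continuous_atP => e e0.
  have e2 : 0 < e / 2 by lra.
  have [d d0 Hd] := gconv_locally_uniform cphi (`|t| + `|x|) e2.
  exists d => // y yx; apply: (@le_lt_trans _ _ (e / 2)); last by lra.
  by apply: Hd; rewrite ?subrr ?normr0// ?lerDl ?lerDr.
apply/Defs.bounded_funP.
have [m m0 Hm] := continuous_locally_bounded cphi `|t|.
exists (2 * (N * m) * `|t|) => x; apply: gconv_le => // r rt.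
by apply: Hm; exact: norm_le_between.
Qed.

Definition conv_Cb phi (cphi : continuous phi) t : Cb R :=
  MkCb (conv_Cb_subproof cphi t).

End convolution.
(** * Real and complex sequences converging geometrically *)

Section geometric_limits.
Variable R : realType.
Local Notation C := (Rcomplex R).

Lemma halfn_lt (K e : R) : 0 < e -> exists n : nat, K * 2^-1 ^+ n < e.
Proof.
move=> e0; pose n := (Num.truncn (`|K| / e)).+1; exists n.
have Kn : `|K| / e < n%:R by exact: truncnS_gt.
have n2 : (n%:R : R) < 2 ^+ n by rewrite -natrX ltr_nat ltn_expl.
rewrite exprVn ltr_pdivrMr ?exprn_gt0//.
apply: le_lt_trans (ler_norm K) _.
by rewrite mulrC -ltr_pdivrMr// (lt_trans Kn).
Qed.

(** The intervals of radius [K / 2^n] around [u n] meet pairwise, so the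
    supremum of their left ends lies in all of them. *)
Lemma real_geometric_limit (u : nat -> R) (K : R) :
  (forall n k, `|u (n + k)%N - u n| <= K * 2^-1 ^+ n) ->
  exists l : R, forall n, `|l - u n| <= K * 2^-1 ^+ n.
Proof.
move=> H; pose E := [set u n - K * 2^-1 ^+ n | n in [set: nat]].
(* Any left end is below any right end; by the symmetry [u |-> - u] it suffices
   to take [n <= m]. *)
have le_nm n m : u n - K * 2^-1 ^+ n <= u m + K * 2^-1 ^+ m.
  wlog nm : n m u H {E} / (n <= m)%N => [W|].
    case: (leqP n m) => [|/ltnW] nm; first exact: W.
    have := W m n (fun i => - u i) _ nm; rewrite -lerN2.
    have -> : - (- u n + K * 2^-1 ^+ n) = u n - K * 2^-1 ^+ n by ring.
    have -> : - (- u m - K * 2^-1 ^+ m) = u m + K * 2^-1 ^+ m by ring.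
    apply=> i j; rewrite -opprD normrN; exact: H.
  have := H n (m - n)%N; rewrite subnKC// ler_norml => /andP[+ _].
  have : 0 <= K * 2^-1 ^+ m by apply: le_trans (H m 0%N).
  lra.
have ubE m : ubound E (u m + K * 2^-1 ^+ m) by move=> _ [n _ <-].
exists (sup E) => n; rewrite ler_norml; apply/andP; split.
  have : u n - K * 2^-1 ^+ n <= sup E.
    by apply: ub_le_sup; [exists (u 0%N + K * 2^-1 ^+ 0); exact: ubE|exists n].
  lra.
have : sup E <= u n + K * 2^-1 ^+ n.
  by apply: ge_sup; [exists (u 0%N - K * 2^-1 ^+ 0), 0%N|exact: ubE].
lra.
Qed.

Lemma complex_geometric_limit (u : nat -> C) (K : R) :
  (forall n k, `|u (n + k)%N - u n| <= K * 2^-1 ^+ n) ->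
  exists l : C, forall n, `|l - u n| <= 2 * K * 2^-1 ^+ n.
Proof.
move=> H.
have [|a Ha] := @real_geometric_limit (fun n => complex.Re (u n)) K.
  by move=> n k; rewrite -raddfB (le_trans (Rcomplex_norm_Re _)).
have [|b Hb] := @real_geometric_limit (fun n => complex.Im (u n)) K.
  by move=> n k; rewrite -raddfB (le_trans (Rcomplex_norm_Im _)).
exists (a +i* b)%C => n; apply: le_trans (norm_le_ReIm _) _.
rewrite !raddfB/=; have := Ha n; have := Hb n; lra.
Qed.

End geometric_limits.

(** * The topologies on bounded continuous functions *)

Section co_convergence.
Variable R : realType.
Implicit Types f : Cb R.

(** Every compact set lies in some interval [[-A, A]], and these are compact. *)
Lemma co_cvgP T (F : set_system T) {FF : Filter F} (u : T -> Cb R) f :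
  co_cvg F u f <-> forall A e : R, 0 < e ->
    \forall t \near F, forall x, `|x| <= A -> `|u t x - f x| <= e.
Proof.
split=> [uf A e e0|H K cK].
  have /cvgrPdist_lt/(_ e e0) := uf `[- A, A]%classic (@segment_compact _ _ _).
  apply: filterS => t; rewrite sub0r normrN => /ltW te x xA.
  apply: le_trans te; apply: le_trans (ler_norm _).
  by apply: (@co_seminorm_ub _ _ (u t - f)); rewrite /= in_itv/= -ler_norml.
have [A [_ HA]] := compact_bounded cK.
apply/cvgrPdist_le => e e0; have := H (A + 1) e e0.
apply: filterS => t ut; rewrite sub0r normrN ger0_norm ?co_seminorm_ge0//.
apply: co_seminorm_le; first exact: ltW.
by move=> x Kx; apply: ut; apply: (HA (A + 1)) => //; rewrite ltrDl.
Qed.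

Lemma le_sup_norm f x : `|f x| <= sup_norm f.
Proof. exact: (@co_seminorm_ub _ [set: R]). Qed.

Lemma sup_norm_le f b : (forall x, `|f x| <= b) -> sup_norm f <= b.
Proof.
move=> fb; apply: (@co_seminorm_le _ [set: R]) => //.
exact: le_trans (fb 0).
Qed.

Lemma sup_norm_ge0 f : 0 <= sup_norm f.
Proof. exact: (@co_seminorm_ge0 _ [set: R]). Qed.

End co_convergence.

(** * The Volterra equation *)

Section volterra.
Variable R : realType.
Local Notation C := (Rcomplex R).
Variables (g : R -> C) (N : R).
Hypothesis gN : forall x, `|g x| <= N.
Hypothesis lg : loc_bounded_measurableC g.
Variables (Phi : Cb R -> C) (M : R).
Hypothesis M0 : 0 <= M.
Hypothesis PhiD : forall f k : Cb R, Phi (f + k) = Phi f + Phi k.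
Hypothesis PhiZ : forall (c : C) (f : Cb R), Phi (c *: f) = c * Phi f.
Hypothesis Phi_tight : tight_functional Phi M.

Let N0 : 0 <= N.
Proof. exact: le_trans (normr_ge0 _) (gN 0). Qed.

Lemma PhiB f k : Phi (f - k) = Phi f - Phi k.
Proof. by rewrite PhiD -scaleN1r PhiZ mulN1r. Qed.

Lemma Phi_le (f : Cb R) b : (forall x, `|f x| <= b) -> `|Phi f| <= (M + 1) * b.
Proof.
move=> fb; have b0 : 0 <= b by exact: le_trans (fb 0).
have [A HA] := Phi_tight ltr01.
by rewrite mulrDl; apply: HA.
Qed.

(** Tightness lets [Phi] pass from locally uniform convergence of bounded
    families to convergence of values. *)
Lemma Phi_continuous (u : R -> Cb R) :
  (forall A : R, exists B : R, forall t x, `|t| <= A -> `|u t x| <= B) ->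
  (forall A e : R, 0 < e -> exists2 d : R, 0 < d & forall t t' x,
    `|t| <= A -> `|x| <= A -> `|t' - t| < d -> `|u t' x - u t x| <= e) ->
  continuous (fun t => Phi (u t)).
Proof.
move=> bu uu t; apply/continuous_atP => e e0; have M0' := M0.
have [B uB] := bu (`|t| + 1).
have B0 : 0 <= B by apply: le_trans (uB t 0 _); rewrite ?lerDl.
have e1 : 0 < e / (2 * (2 * B + 1)) by rewrite divr_gt0//; lra.
have [A HA] := Phi_tight e1.
have e2 : 0 < e / (2 * (M + 1)) by rewrite divr_gt0//; lra.
have [d d0 ud] := uu (`|t| + `|A|) _ e2.
exists (Num.min d 1); first by rewrite lt_min d0 ltr01.
move=> s; rewrite lt_min => /andP[sd s1]; rewrite -PhiB.
apply: le_lt_trans (HA _ (e / (2 * (M + 1))) (2 * B) (ltW e2) _ _ _) _.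
- lra.
- move=> x xA; apply: ud => //; first by rewrite lerDl.
  by rewrite (le_trans xA)// (le_trans (ler_norm A))// lerDr.
- move=> x; apply: le_trans (ler_normB _ _) _.
  have uB1 : `|u s x| <= B.
    apply: uB; rewrite -(subrK t s) (le_trans (ler_normD _ _))//; lra.
  have uB2 : `|u t x| <= B by apply: uB; lra.
  lra.
- have E1 : (M + 1) * (e / (2 * (M + 1))) = e / 2 by field; lra.
  have E2 : e / (2 * (2 * B + 1)) * (2 * B + 1) = e / 2 by field; lra.
  nra.
Qed.

Fact translate_subproof (t : R) (f : Cb R) :
  (fun x => f (x + t) : C) \in @Cb_pred R.
Proof.
apply/mem_set; split.
  move=> x; apply: (@cvg_comp _ _ _ (fun x => x + t) f); last exact: Cb_continuous.
  by apply: cvgD; [exact: cvg_id|exact: cvg_cst].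
apply/Defs.bounded_funP; have [m fm] := Cb_bounded f.
by exists m => x; exact: fm.
Qed.

Definition translate t f : Cb R := MkCb (translate_subproof t f).

Definition cfun := {phi : R -> C | continuous phi}.
Implicit Types (phi psi : cfun) (f : Cb R).

Definition conv_of phi t : Cb R := conv_Cb gN lg (svalP phi) t.

(** Variation of constants with an arbitrary input [phi] in place of the
    self-consistent one. *)
Definition trajectory f phi t : Cb R := translate t f + conv_of phi t.

Definition volterra f phi := forall t : R, 0 <= t -> sval phi t = Phi (trajectory f phi t).

Lemma trajectory_bounded f phi (A : R) :
  exists B : R, forall t x, `|t| <= A -> `|trajectory f phi t x| <= B.
Proof.
have [m fm] := Cb_bounded f.
have [p p0 pm] := continuous_locally_bounded (svalP phi) A.
exists (m + 2 * (N * p) * A) => t x tA.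
rewrite (le_trans (ler_normD _ _))// lerD//; first exact: fm.
apply: (@le_trans _ _ (2 * (N * p) * `|t|)).
  apply: (gconv_le gN lg x (svalP phi)) => r rt.
  by apply: pm; apply: le_trans tA; exact: norm_le_between.
by rewrite ler_wpM2l// !mulr_ge0.
Qed.

Lemma trajectory_locally_uniform f phi (A e : R) : 0 < e ->
  exists2 d : R, 0 < d & forall t t' x, `|t| <= A -> `|x| <= A ->
    `|t' - t| < d -> `|trajectory f phi t' x - trajectory f phi t x| <= e.
Proof.
move=> e0; have e2 : 0 < e / 2 by lra.
have [d1 d10 H1] := continuous_locally_uniform (@Cb_continuous _ f) (A + A) e2.
have [d2 d20 H2] := gconv_locally_uniform gN lg (svalP phi) A e2.
exists (Num.min d1 d2); first by rewrite lt_min d10.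
move=> t t' x tA xA; rewrite lt_min => /andP[td1 td2].
have I1 : `|f (x + t') - f (x + t)| <= e / 2.
  apply: H1; first by rewrite (le_trans (ler_normD _ _))// lerD.
  by have -> : x + t' - (x + t) = t' - t by ring.
have I2 : `|gconv g (sval phi) t' x - gconv g (sval phi) t x| <= e / 2.
  by apply: H2 => //; rewrite subrr normr0.
have -> : trajectory f phi t' x - trajectory f phi t x =
    (f (x + t') - f (x + t)) + (gconv g (sval phi) t' x - gconv g (sval phi) t x).
  by rewrite /trajectory/= opprD addrACA.
rewrite (le_trans (ler_normD _ _))//; lra.
Qed.

(** With this rate, [(M + 1) * 2 N / w <= 1 / 2]: here [M + 1] bounds the norm
    of [Phi] and [2 N / w] that of the convolution in the weighted norm. *)
Let w : R := 4 * ((M + 1) * N) + 1.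

Let w0 : 0 < w.
Proof. by have M0' := M0; rewrite /w ltr_wpDl// !mulr_ge0//; lra. Qed.


Lemma Phi_conv_le phi (t L : R) : 0 <= t ->
  (forall r, 0 <= r <= t -> `|sval phi r| <= L * expR (w * r)) ->
  `|Phi (conv_of phi t)| <= L / 2 * expR (w * t).
Proof.
move=> t0 phiL; have w0' := w0.
have L0 : 0 <= L.
  have /phiL : 0 <= (0 : R) <= t by rewrite lexx.
  by rewrite mulr0 expR0 mulr1; exact: le_trans.
apply: le_trans (@Phi_le _ (2 * (N * L / w) * expR (w * t)) _) _.
  by move=> x; exact: (gconv_exp_le gN lg x (svalP phi) t0 w0).
rewrite mulrA ler_wpM2r ?expR_ge0//.
have -> : (M + 1) * (2 * (N * L / w)) = (4 * ((M + 1) * N)) / w * (L / 2).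
  by field; lra.
rewrite ler_piMl//; first lra.
by rewrite ler_pdivrMr// mul1r /w; lra.
Qed.

(** At the point where the weighted modulus of [phi] attains its maximum [B] on
    [[0, s]], the equation gives [B <= A + B / 2]. Working on a compact interval
    makes this available without any growth assumption on [phi]. *)
Lemma volterra_apriori phi (s A : R) :
  (forall t, 0 <= t <= s ->
    `|sval phi t - Phi (conv_of phi t)| <= A * expR (w * t)) ->
  forall t, 0 <= t <= s -> `|sval phi t| <= 2 * A * expR (w * t).
Proof.
move=> H t /andP[t0 ts]; have s0 : 0 <= s by lra.
pose k r : R := `|sval phi r| * expR (- (w * r)).
have ck : continuous k.
  move=> r; apply: cvgM; first by apply: cvg_norm; exact: (svalP phi).
  apply: (@cvg_comp _ _ _ (fun r => - (w * r)) expR).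
    by apply: cvgN; apply: cvgM; [exact: cvg_cst|exact: cvg_id].
  exact: continuous_expR.
have kE r : `|sval phi r| = k r * expR (w * r).
  by rewrite /k -mulrA -expRD addNr expR0 mulr1.
(* [c] is the point where the weighted modulus is largest. *)
have [c + Hc] := EVT_max s0 (continuous_subspaceT ck).
rewrite in_itv/= => /andP[c0 cs].
have kc r : 0 <= r <= s -> k r <= k c by move=> rs; apply: Hc; rewrite in_itv.
have I1 : `|Phi (conv_of phi c)| <= k c / 2 * expR (w * c).
  apply: Phi_conv_le => // r /andP[r0 rc]; rewrite kE ler_wpM2r ?expR_ge0//.
  by apply: kc; apply/andP; split; lra.
have I2 : k c * expR (w * c) <= (A + k c / 2) * expR (w * c).
  rewrite -kE -(subrK (Phi (conv_of phi c)) (sval phi c)).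
  rewrite (le_trans (ler_normD _ _))// mulrDl lerD//.
  by apply: H; rewrite c0.
rewrite ler_pM2r ?expR_gt0// in I2.
rewrite kE ler_wpM2r ?expR_ge0//.
have : k t <= k c by apply: kc; rewrite t0.
lra.
Qed.

Fact clin_subproof (c : C) phi psi :
  continuous (fun t => c * sval phi t + sval psi t : C).
Proof.
move=> t; apply: cvgD; last exact: (svalP psi).
by apply: Rcomplex_cvgZl; exact: (svalP phi).
Qed.

Definition clin (c : C) phi psi : cfun := exist _ _ (@clin_subproof c phi psi).

Lemma conv_of_lin c phi psi t :
  conv_of (clin c phi psi) t = c *: conv_of phi t + conv_of psi t.
Proof.
have cc : continuous (fun t => c * sval phi t : C).
  by move=> r; apply: Rcomplex_cvgZl; exact: (svalP phi).
apply: CbP => x; rewrite /= (gconvD lg _ _ cc (svalP psi)).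
by rewrite (gconvZ lg c _ _ (svalP phi)).
Qed.

Let cdiff phi psi := clin (-1) psi phi.

Let cdiffE phi psi t : sval (cdiff phi psi) t = sval phi t - sval psi t.
Proof. by rewrite /= mulN1r addrC. Qed.

Let conv_of_diff phi psi t :
  conv_of (cdiff phi psi) t = conv_of phi t - conv_of psi t.
Proof. by rewrite conv_of_lin scaleN1r addrC. Qed.

Lemma Phi_conv_contraction phi psi (t L : R) : 0 <= t ->
  (forall r, 0 <= r <= t -> `|sval phi r - sval psi r| <= L * expR (w * r)) ->
  `|Phi (conv_of phi t) - Phi (conv_of psi t)| <= L / 2 * expR (w * t).
Proof.
move=> t0 H; rewrite -PhiB -conv_of_diff; apply: Phi_conv_le => // r rt.
by rewrite cdiffE; exact: H.
Qed.

Lemma volterra_bound f phi (s a : R) : volterra f phi ->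
  (forall t, 0 <= t <= s -> `|Phi (translate t f)| <= a) ->
  forall t, 0 <= t <= s -> `|sval phi t| <= 2 * a * expR (w * t).
Proof.
move=> fphi fa; apply: volterra_apriori => t /andP[t0 ts].
rewrite fphi// /trajectory PhiD addrK (le_trans (fa t _)) ?t0//.
rewrite ler_peMr//; first by rewrite (le_trans _ (fa t _)) ?t0.
by rewrite -expR0 ler_expR mulr_ge0// ltW.
Qed.

Lemma volterra_lin c f k phi psi : volterra f phi -> volterra k psi ->
  volterra (c *: f + k) (clin c phi psi).
Proof.
move=> fphi kpsi t t0 /=; rewrite fphi// kpsi// -PhiZ -PhiD.
congr Phi; rewrite /trajectory conv_of_lin scalerDr addrACA; congr (_ + _).
exact: CbP.
Qed.

(** The difference of two solutions solves the equation with datum 0. *)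
Lemma volterra_uniq f phi psi : volterra f phi -> volterra f psi ->
  forall t, 0 <= t -> sval phi t = sval psi t.
Proof.
move=> fphi fpsi t t0; apply/eqP; rewrite -subr_eq0 -normr_le0 -cdiffE.
have : volterra 0 (cdiff phi psi).
  have -> : 0 = (-1) *: f + f :> Cb R by rewrite scaleN1r addNr.
  exact: volterra_lin.
move=> /(@volterra_bound _ _ t 0) H.
have := H _ t; rewrite t0 lexx mulr0 mul0r; apply => // r _.
have -> : translate r 0 = 0 :> Cb R by exact: CbP.
by rewrite -(subrr (0 : Cb R)) PhiB subrr normr0.
Qed.

(** The time is truncated at 0 so that the iterates are continuous functions on
    the whole line; on negative times they are constant. *)
Fact step_subproof f phi :
  continuous (fun t : R => Phi (trajectory f phi (Num.max 0 t))).
Proof.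
move=> t; apply/continuous_atP => e e0.
have := @Phi_continuous (trajectory f phi) (trajectory_bounded f phi) (trajectory_locally_uniform f phi).
move=> /(_ (Num.max 0 t)) /continuous_atP /(_ e e0)[d d0 Hd].
exists d => // s st; apply: Hd; apply: le_lt_trans st.
have := ler_norm (s - t); have := ler_norm (t - s); rewrite distrC.
case: (leP 0 t) => t0; case: (leP 0 s) => s0 //; rewrite ler_norml;
  move=> ? ?; apply/andP; split; lra.
Qed.

Definition step f phi : cfun := exist _ _ (@step_subproof f phi).

Fact zero_subproof : continuous (fun _ : R => 0 : C).
Proof. by move=> t; exact: cvg_cst. Qed.

Let iterate f n : cfun := iter n (step f) (exist _ _ zero_subproof).

Let stepE f phi t : 0 <= t -> sval (step f phi) t = Phi (trajectory f phi t).
Proof. by move=> t0; rewrite /= max_r. Qed.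

Let step_contraction f phi psi (t L : R) : 0 <= t ->
  (forall r, 0 <= r <= t -> `|sval phi r - sval psi r| <= L * expR (w * r)) ->
  `|sval (step f phi) t - sval (step f psi) t| <= L / 2 * expR (w * t).
Proof.
move=> t0 H; rewrite !stepE// /trajectory !PhiD opprD addrACA subrr add0r.
exact: Phi_conv_contraction.
Qed.

(** Picard iteration from 0. Consecutive iterates differ by at most
    [L 2^-n exp(w t)], so they converge locally uniformly on [t >= 0] and the
    limit is a continuous fixed point. *)
Lemma volterra_exists f : exists phi, volterra f phi.
Proof.
have [m fm] := Cb_bounded f.
have m0 : 0 <= m by exact: le_trans (fm 0).
pose L : R := (M + 1) * m.
have L0 : 0 <= L by rewrite /L mulr_ge0// addr_ge0.
have e1 t : 0 <= t -> 1 <= expR (w * t).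
  by move=> t0; rewrite -expR0 ler_expR mulr_ge0// ltW.
have step1 n t : 0 <= t ->
    `|sval (iterate f n.+1) t - sval (iterate f n) t| <= L * 2^-1 ^+ n * expR (w * t).
  elim: n t => [|n IH] t t0.
    have -> : sval (iterate f 0) t = 0 by [].
    rewrite subr0 stepE// /trajectory PhiD expr0 mulr1.
    have -> : Phi (conv_of (iterate f 0) t) = 0.
      apply/eqP; rewrite -normr_le0 (le_trans (@Phi_conv_le _ t 0 t0 _))//.
        by move=> r _; rewrite /= normr0 mul0r.
    rewrite addr0 (le_trans (@Phi_le _ m _))//; first by move=> x; exact: fm.
    by rewrite ler_peMr// e1.
  have -> : L * 2^-1 ^+ n.+1 = (L * 2^-1 ^+ n) / 2 by rewrite exprSr mulrA.
  by apply: step_contraction => // r /andP[r0 _]; exact: IH.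
have cauchy n k t : 0 <= t -> `|sval (iterate f (n + k)%N) t - sval (iterate f n) t| <=
    2 * L * expR (w * t) * (2^-1 ^+ n - 2^-1 ^+ (n + k)).
  move=> t0; elim: k => [|k IH]; first by rewrite addn0 !subrr normr0 mulr0.
  rewrite addnS -(subrKA (sval (iterate f (n + k)%N) t)).
  rewrite (le_trans (ler_normD _ _))//.
  have := step1 (n + k)%N t t0; rewrite [2^-1 ^+ (n + k).+1]exprSr.
  move: (expR (w * t)) (2^-1 ^+ (n + k)) (2^-1 ^+ n) IH => E p q; lra.
have lim t : exists l : C, 0 <= t -> forall n,
    `|l - sval (iterate f n) t| <= 4 * L * expR (w * t) * 2^-1 ^+ n.
  case: (leP 0 t) => t0; last by exists 0.
  have [|l Hl] := @complex_geometric_limit _ (fun n => sval (iterate f n) t)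
    (2 * L * expR (w * t)).
    move=> n k; apply: le_trans (cauchy n k t t0) _.
    have E0 : 0 <= 2 * L * expR (w * t) by rewrite mulr_ge0 ?expR_ge0// mulr_ge0.
    by rewrite ler_wpM2l// lerBlDr lerDl exprn_ge0.
  exists l => _ n; apply: le_trans (Hl n) _.
  by rewrite !mulrA -natrM.
have [l Hl] := choice lim.
have cl : continuous (fun t : R => l (Num.max 0 t)).
  move=> t; apply/continuous_atP => e e0.
  pose E := expR (w * (`|t| + 1)).
  have [n Hn] := @halfn_lt _ (4 * L * E) (e / 4) ltac:(lra).
  have near_l s : `|s - t| < 1 ->
      `|l (Num.max 0 s) - sval (iterate f n) (Num.max 0 s)| <= e / 4.
    move=> st; apply: le_trans (ltW Hn).
    apply: le_trans (Hl _ _ n) _; first by rewrite le_max lexx.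
    have L4 : 0 <= 4 * L by rewrite mulr_ge0.
    rewrite ler_wpM2r ?exprn_ge0// ler_wpM2l// ler_expR ler_wpM2l ?(ltW w0)//.
    rewrite ge_max addr_ge0//=.
    rewrite -(subrK t s) (le_trans (ler_norm _))// (le_trans (ler_normD _ _))//; lra.
  have := (continuous_atP _ _).1 (svalP (iterate f n) (Num.max 0 t)) (e / 4) ltac:(lra).
  move=> [d d0 Hd]; exists (Num.min d 1); first by rewrite lt_min d0 ltr01.
  move=> s; rewrite lt_min => /andP[sd s1].
  have I1 := near_l s s1.
  have I2 := near_l t; rewrite subrr normr0 in I2; have {}I2 := I2 ltr01.
  have I3 : `|sval (iterate f n) (Num.max 0 s) - sval (iterate f n) (Num.max 0 t)| < e / 4.
    apply: Hd; apply: le_lt_trans sd.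
    have := ler_norm (s - t); have := ler_norm (t - s); rewrite distrC.
    case: (leP 0 t) => t0; case: (leP 0 s) => s0 //; rewrite ler_norml;
      move=> ? ?; apply/andP; split; lra.
  rewrite distrC in I2.
  rewrite -(subrKA (sval (iterate f n) (Num.max 0 s))) (le_lt_trans (ler_normD _ _))//.
  rewrite -(subrKA (sval (iterate f n) (Num.max 0 t)) (sval (iterate f n) (Num.max 0 s))).
  have := ler_normD (sval (iterate f n) (Num.max 0 s) - sval (iterate f n) (Num.max 0 t))
    (sval (iterate f n) (Num.max 0 t) - l (Num.max 0 t)).
  lra.
pose phi : cfun := exist _ _ cl; exists phi => t t0.
have phiE (r : R) : 0 <= r -> sval phi r = l r by move=> r0; rewrite /= max_r.
rewrite -stepE//; apply/eqP; rewrite -subr_eq0 -normr_le0 leNgt; apply/negP => neq.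
have [n Hn] := halfn_lt (4 * L * expR (w * t)) neq.
have I1 := Hl t t0 n.+1.
have I2 : `|sval (iterate f n.+1) t - sval (step f phi) t| <=
    4 * L * 2^-1 ^+ n / 2 * expR (w * t).
  apply: step_contraction => // r /andP[r0 _].
  by rewrite phiE// distrC mulrAC; exact: Hl.
move: neq Hn; rewrite phiE// -(subrKA (sval (iterate f n.+1) t)).
move=> _; apply/negP; rewrite -leNgt (le_trans (ler_normD _ _))//.
move: I1 I2; rewrite exprSr; move: (expR _) (2^-1 ^+ n) => E p; lra.
Qed.

Fact shift_subproof s phi : continuous (fun t => sval phi (t + s)).
Proof.
move=> t; apply: (@cvg_comp _ _ _ (fun t => t + s) (sval phi)); last exact: (svalP phi).
by apply: cvgD; [exact: cvg_id|exact: cvg_cst].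
Qed.

Definition shift s phi : cfun := exist _ _ (@shift_subproof s phi).

Lemma trajectory_shift f phi t s :
  trajectory f phi (t + s) = trajectory (trajectory f phi s) (shift s phi) t.
Proof.
apply: CbP => x.
rewrite -[LHS]/(f (x + (t + s)) + gconv g (sval phi) (t + s) x).
by rewrite (gconv_cat lg t s x (svalP phi)) !addrA.
Qed.

(** Restarting the evolution at time [s]. *)
Lemma volterra_shift f phi s : 0 <= s -> volterra f phi ->
  volterra (trajectory f phi s) (shift s phi).
Proof.
by move=> s0 fphi t t0; rewrite /= fphi ?addr_ge0// trajectory_shift.
Qed.

(** The convolution up to time [t] only sees the input on [[0, t]]. *)
Lemma trajectory_eq f phi psi t : 0 <= t ->
  (forall r, 0 <= r <= t -> sval phi r = sval psi r) ->
  trajectory f phi t = trajectory f psi t.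
Proof.
move=> t0 H; congr (_ + _); apply/eqP; rewrite -subr_eq0 -conv_of_diff; apply/eqP.
apply: CbP => x; apply/eqP; rewrite -normr_le0.
apply: (le_trans (gconv_exp_le gN lg x (svalP (cdiff phi psi)) t0 ltr01 (L := 0) _)).
  by move=> r rt; rewrite cdiffE H// subrr normr0 mul0r.
by rewrite !(mulr0, mul0r).
Qed.

Lemma trajectory_le f phi (t x b L : R) : 0 <= t -> 0 <= L -> `|f (x + t)| <= b ->
  (forall r, 0 <= r <= t -> `|sval phi r| <= 2 * L * expR (w * r)) ->
  `|trajectory f phi t x| <= b + L * expR (w * t).
Proof.
move=> t0 L0 fb phiL; rewrite (le_trans (ler_normD _ _))// lerD//.
rewrite (le_trans (gconv_exp_le gN lg x (svalP phi) t0 w0 phiL))//.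
rewrite ler_wpM2r ?expR_ge0//.
have -> : 2 * (N * (2 * L) / w) = (4 * N) / w * L by ring.
rewrite ler_piMl// ler_pdivrMr ?w0// mul1r.
have : 0 <= M * N by rewrite mulr_ge0.
rewrite /w; have := N0; lra.
Qed.


(** * The semigroup *)

Definition volterra_solution f : cfun := projT1 (cid (volterra_exists f)).

Lemma volterra_solutionP f : volterra f (volterra_solution f).
Proof. exact: projT2 (cid (volterra_exists f)). Qed.

(** Truncating the time at 0 makes this a linear operator for every real [t]. *)
Definition evolution (t : R) f : Cb R := trajectory f (volterra_solution f) (Num.max 0 t).

Lemma evolutionE f phi t : volterra f phi -> 0 <= t ->
  evolution t f = trajectory f phi t.
Proof.
move=> fphi t0; rewrite /evolution max_r//; apply: trajectory_eq => // r /andP[r0 _].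
exact: volterra_uniq (volterra_solutionP f) fphi r r0.
Qed.

Fact evolution_linear t : linear (evolution t).
Proof.
move=> c f k; have t0 : 0 <= Num.max 0 t by rewrite le_max lexx.
have E h : evolution t h = evolution (Num.max 0 t) h.
  by rewrite /evolution maxA maxxx.
have [Hf Hk] := (volterra_solutionP f, volterra_solutionP k).
rewrite !E (evolutionE (volterra_lin c Hf Hk) t0).
rewrite (evolutionE Hf t0) (evolutionE Hk t0).
rewrite /trajectory conv_of_lin scalerDr addrACA; congr (_ + _).
exact: CbP.
Qed.

HB.instance Definition _ t := GRing.isLinear.Build C (Cb R) (Cb R) *:%R
  (evolution t) (evolution_linear t).

Definition semigroup (t : R) : {linear Cb R -> Cb R} := evolution t.

Lemma semigroup_bound f a b (s t x : R) :
  0 <= t <= s -> 0 <= a -> `|f (x + t)| <= b ->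
  (forall r, 0 <= r <= s -> `|Phi (translate r f)| <= a) ->
  `|evolution t f x| <= b + a * expR (w * t).
Proof.
move=> /andP[t0 ts] a0 fb fa.
rewrite (evolutionE (volterra_solutionP f) t0).
apply: trajectory_le => // r /andP[r0 rt].
apply: (volterra_bound (volterra_solutionP f) fa).
by rewrite r0 (le_trans rt).
Qed.

(** The input [phi] of [f n] on [[0, s]] is controlled by the values of [Phi]
    on the translates of [f n], which are small by tightness once [f n] is small
    on an interval longer by [s]. *)
Lemma semigroup_equicontinuous (s : R) : 0 < s ->
  bi_equicontinuous [set (semigroup t : Cb R -> Cb R) | t in `[0, s]].
Proof.
move=> s0 f [m fm] /co_cvgP f0 K cK e e0.
have M0' := M0; have w0' := ltW w0.
have [A [_ HA]] := compact_bounded cK.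
pose E := expR (w * s).
have E0 : 0 < E by exact: expR_gt0.
have [a a0 aE] : exists2 a : R, 0 < a & a * E = e / 4.
  exists (e / (4 * E)); first by rewrite divr_gt0// mulr_gt0.
  by field; lra.
have a2 : 0 < a / 2 by lra.
have m1 : 0 < Num.max 0 m + 1 by rewrite ltr_wpDl// le_max lexx.
have e1 : 0 < a / 2 / (Num.max 0 m + 1) by rewrite divr_gt0.
have [B HB] := Phi_tight e1.
have e2 : 0 < a / 2 / (M + 1) by rewrite divr_gt0//; lra.
have e4 : 0 < e / 4 by lra.
have near1 := f0 (B + s) _ e2.
have near2 := f0 (A + 1 + s) _ e4.
near=> n => T [t /=]; rewrite in_itv/= => /andP[t0 ts] <-.
have fa r : 0 <= r <= s -> `|Phi (translate r (f n))| <= a.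
  move=> /andP[r0 rs].
  apply: le_trans (HB _ (a / 2 / (M + 1)) (Num.max 0 m) (ltW e2) _ _ _) _.
  - by rewrite le_max lexx.
  - move=> x xB.
    have : forall x, `|x| <= B + s -> `|f n x - (0 : Cb R) x| <= a / 2 / (M + 1).
      by near: n.
    move=> /(_ (x + r)); rewrite subr0; apply.
    by rewrite (le_trans (ler_normD _ _))// lerD// ger0_norm.
  - by move=> x; apply: le_trans (le_sup_norm (f n) _) _; rewrite le_max fm orbT.
  - have -> : M * (a / 2 / (M + 1)) = a / 2 - a / 2 / (M + 1) by field; lra.
    have -> : a / 2 / (Num.max 0 m + 1) * Num.max 0 m =
      a / 2 - a / 2 / (Num.max 0 m + 1) by field; lra.
    lra.
apply: (@le_lt_trans _ _ (e / 2)); last by lra.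
apply: co_seminorm_le; first by lra.
move=> x Kx; apply: le_trans (semigroup_bound (b := e / 4) _ (ltW a0) _ fa) _.
- by rewrite t0.
- have : forall x, `|x| <= A + 1 + s -> `|f n x - (0 : Cb R) x| <= e / 4 by near: n.
  move=> /(_ (x + t)); rewrite subr0; apply.
  rewrite (le_trans (ler_normD _ _))// lerD ?(ger0_norm t0)//.
  by apply: (HA (A + 1)) => //; rewrite ltrDl.
- have : a * expR (w * t) <= a * E.
    by rewrite ler_wpM2l ?(ltW a0)// ler_expR ler_wpM2l.
  lra.
Unshelve. all: by end_near. Qed.

Lemma semigroup_exp_bound f (t : R) : 0 <= t ->
  sup_norm (semigroup t f) <= (M + 2) * expR (w * t) * sup_norm f.
Proof.
move=> t0; have M0' := M0; have w0' := ltW w0; have f0 := sup_norm_ge0 f.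
apply: sup_norm_le => x.
apply: le_trans (semigroup_bound (s := t) (a := (M + 1) * sup_norm f)
  (b := sup_norm f) _ _ _ _) _.
- by rewrite t0 lexx.
- by rewrite mulr_ge0//; lra.
- exact: le_sup_norm.
- by move=> r _; apply: Phi_le => y; exact: (le_sup_norm f (y + r)).
- have : 0 <= (expR (w * t) - 1) * sup_norm f.
    by rewrite mulr_ge0// subr_ge0 -expR0 ler_expR mulr_ge0.
  move: (expR _) (sup_norm f) f0 => E p p0 H; nra.
Qed.

Lemma semigroup_continuous f (t : R) : 0 <= t ->
  co_cvg (within `[0, +oo[%classic (nbhs t)) (semigroup ^~ f) (semigroup t f).
Proof.
move=> t0; apply/co_cvgP => A e e0.
pose phi := volterra_solution f.
have [d d0 Hd] := trajectory_locally_uniform f phi (Num.max `|t| A) e0.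
apply/nbhs_ballP; exists d => //= s.
rewrite /ball/= distrC in_itv/= andbT => st s0 x xA.
rewrite -[leLHS]/(`|evolution s f x - evolution t f x|).
rewrite !(evolutionE (volterra_solutionP f))//.
by apply: Hd; rewrite // le_max ?lexx ?xA ?orbT.
Qed.

Lemma semigroup_law (t s : R) f : 0 <= t -> 0 <= s ->
  semigroup (t + s) f = semigroup t (semigroup s f).
Proof.
move=> t0 s0; rewrite -[LHS]/(evolution (t + s) f) -[RHS]/(evolution t (evolution s f)).
rewrite (evolutionE (volterra_solutionP f) (addr_ge0 t0 s0)).
rewrite trajectory_shift (evolutionE (volterra_solutionP f) s0).
by rewrite (evolutionE (volterra_shift s0 (volterra_solutionP f)) t0).
Qed.

Lemma semigroup0 f : semigroup 0 f = f.
Proof.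
rewrite -[LHS]/(evolution 0 f) (evolutionE (volterra_solutionP f) (lexx 0)).
apply: CbP => x.
rewrite -[LHS]/(f (x + 0) + cint x (x + 0) _).
by rewrite addr0 cintxx addr0.
Qed.

Lemma semigroup_bi_continuous : bi_continuous_semigroup semigroup.
Proof.
split.
- exact: semigroup_law.
- exact: semigroup0.
- exact: semigroup_continuous.
- exists (M + 2), w; split; first by have M0' := M0; lra.
  by move=> t f; exact: semigroup_exp_bound.
- exact: semigroup_equicontinuous.
Qed.

Lemma gconv_cst (c : C) t x : gconv g (fun=> c) t x = c * cint x (x + t) g.
Proof. by rewrite -cintZ//; congr cint; apply/funext => y; rewrite mulrC. Qed.

(** Replacing the input by its initial value [Phi f] turns the convolution into
    [Phi f] times an increment of the primitive of [g]; the error is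
    the convolution of the difference. *)
Let remainder f phi (b t x : R) : volterra f phi -> 0 <= t ->
  (forall r, 0 <= r <= t -> `|sval phi r - Phi f| <= b) ->
  `|evolution t f x - f (x + t) - Phi f * cint x (x + t) g| <= 2 * (N * b) * t.
Proof.
move=> fphi t0 phib; rewrite (evolutionE fphi t0) -gconv_cst.
have cp : continuous (fun _ : R => (-1) * Phi f : C) by move=> r; exact: cvg_cst.
have cc : continuous (fun _ : R => Phi f : C) by move=> r; exact: cvg_cst.
have -> : trajectory f phi t x - f (x + t) - gconv g (fun=> Phi f) t x =
    gconv g (fun r => sval phi r + (-1) * Phi f : C) t x.
  rewrite (gconvD lg _ _ (svalP phi) cp) (gconvZ lg (-1) _ _ cc) mulN1r.
  rewrite -[trajectory f phi t x]/(f (x + t) + gconv g (sval phi) t x).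
  by rewrite (addrC (f _)) addrK.
apply: le_trans (gconv_le gN lg x (L := b) _ _) _.
- by move=> r; apply: cvgD; [exact: (svalP phi)|exact: cvg_cst].
- by move=> r; rewrite min_l// max_r// mulN1r; exact: phib.
- by rewrite ger0_norm.
Qed.

Let volterra_solution0 f : sval (volterra_solution f) 0 = Phi f.
Proof.
rewrite (volterra_solutionP f (lexx 0)); congr Phi.
rewrite -[RHS]semigroup0 -[RHS]/(evolution 0 f).
by rewrite (evolutionE (volterra_solutionP f) (lexx 0)).
Qed.

Lemma evolution_first_order f (e : R) : 0 < e -> exists2 d : R, 0 < d &
  forall t x : R, 0 <= t < d ->
    `|evolution t f x - f (x + t) - Phi f * cint x (x + t) g| <= e * t.
Proof.
move=> e0; have N0' := N0.
have e1 : 0 < e / (2 * N + 1) by rewrite divr_gt0//; lra.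
have [d d0 Hd] := (continuous_atP _ _).1 (svalP (volterra_solution f) 0) _ e1.
exists d => // t x /andP[t0 td].
apply: le_trans (remainder (b := e / (2 * N + 1)) x (volterra_solutionP f) t0 _) _.
  move=> r /andP[r0 rt]; rewrite -volterra_solution0 ltW//; apply: Hd.
  by rewrite subr0 ger0_norm//; lra.
rewrite ler_wpM2r//.
have -> : 2 * (N * (e / (2 * N + 1))) = e - e / (2 * N + 1) by field; lra.
lra.
Qed.

Lemma evolution_remainder_bound f : exists B : R, forall t x : R, 0 <= t <= 1 ->
  `|evolution t f x - f (x + t) - Phi f * cint x (x + t) g| <= B * t.
Proof.
have [b b0 Hb] := continuous_locally_bounded (svalP (volterra_solution f)) 1.
exists (2 * (N * (b + `|Phi f|))) => t x /andP[t0 t1].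
apply: remainder (volterra_solutionP f) t0 _ => r /andP[r0 rt].
rewrite (le_trans (ler_normB _ _))// lerD2r; apply: Hb.
by rewrite ger0_norm//; exact: le_trans t1.
Qed.

End volterra.

(** * Derivatives of complex-valued functions *)

Section derivatives.
Variables (R : realType) (V : normedModType R).
Implicit Types u v : R -> V.

(** Differentiability by first-order approximation, which also makes sense at
    [y = x] and avoids the division. *)
Lemma is_derive1P u (x : R) (c : V) : is_derive x 1 u c <->
  forall e : R, 0 < e -> exists2 d : R, 0 < d & forall y, `|y - x| < d ->
    `|u y - u x - (y - x) *: c| <= e * `|y - x|.
Proof.
have E (h : R) : h != 0 ->
    `|c - h^-1 *: (u (h *: 1 + x) - u x)| = `|h|^-1 * `|u (h + x) - u x - h *: c|.
  move=> h0; rewrite -normfV -normrZ [in RHS]scalerBr scalerA mulVf// scale1r distrC.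
  by rewrite [h *: 1]mulr1.
split=> [[du uc] e e0|H].
  have : h^-1 *: (u (h *: 1 + x) - u x) @[h --> 0^'] --> c by rewrite -uc.
  move=> /cvgrPdist_le/(_ e e0)/nbhs_ballP[d /= d0 Hd]; exists d => // y yx.
  have [->|yx0] := eqVneq y x; first by rewrite !subrr scale0r subrr !normr0 mulr0.
  have h0 : y - x != 0 by rewrite subr_eq0.
  have := Hd (y - x); rewrite /ball/= sub0r normrN => /(_ yx h0).
  by rewrite E// subrK mulrC ler_pdivrMr// normr_gt0.
have cu : h^-1 *: (u (h *: 1 + x) - u x) @[h --> 0^'] --> c.
  apply/cvgrPdist_le => e e0; have [d d0 Hd] := H e e0.
  apply/nbhs_ballP; exists d => //= h; rewrite /ball/= sub0r normrN => hd h0.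
  rewrite E//; have := Hd (h + x); rewrite addrK => /(_ hd) {}Hd.
  by rewrite mulrC ler_pdivrMr// normr_gt0.
by split; [exact: cvgP cu|exact: cvg_lim cu].
Qed.

Lemma is_derive1_continuous u (x : R) (c : V) : is_derive x 1 u c ->
  {for x, continuous u}.
Proof.
by move=> [du _]; apply: differentiable_continuous; apply/derivable1_diffP.
Qed.

Lemma is_derive1_unique u (x : R) (c d : V) :
  is_derive x 1 u c -> is_derive x 1 u d -> c = d.
Proof. by move=> [_ <-] [_ <-]. Qed.

End derivatives.

Section complex_derivatives.
Variable R : realType.
Local Notation C := (Rcomplex R).
Implicit Types u v : R -> C.

Lemma is_derive_Re u (x : R) (c : C) : is_derive x 1 u c ->
  is_derive x 1 (fun y => complex.Re (u y)) (complex.Re c).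
Proof.
move=> /is_derive1P H; apply/is_derive1P => e /H[d d0 Hd]; exists d => // y /Hd.
by apply: le_trans; rewrite -linearZ -!raddfB; exact: Rcomplex_norm_Re.
Qed.

Lemma is_derive_Im u (x : R) (c : C) : is_derive x 1 u c ->
  is_derive x 1 (fun y => complex.Im (u y)) (complex.Im c).
Proof.
move=> /is_derive1P H; apply/is_derive1P => e /H[d d0 Hd]; exists d => // y /Hd.
by apply: le_trans; rewrite -linearZ -!raddfB; exact: Rcomplex_norm_Im.
Qed.

Lemma is_derive_mulC u (x : R) (p c : C) : is_derive x 1 u c ->
  is_derive x 1 (fun y => p * u y : C) (p * c : C).
Proof.
move=> /is_derive1P H; apply/is_derive1P => e e0.
have p0 : 0 < `|p| + 1 by rewrite ltr_wpDl.
have [d d0 Hd] := H _ (divr_gt0 e0 p0); exists d => // y /Hd yx.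
have -> : (y - x) *: (p * c : C) = p * ((y - x) *: c).
  by rewrite (mulrC p c) scalerAl mulrC.
rewrite -mulrBr -mulrBr Rcomplex_normM.
apply: le_trans (ler_wpM2l (normr_ge0 p) yx) _.
rewrite mulrA ler_wpM2r// mulrA ler_pdivrMr// mulrC ler_wpM2l ?(ltW e0)//.
by rewrite lerDl.
Qed.

(** The mean value theorem applied to real and imaginary parts, whose
    intermediate points differ; hence an inequality, with a factor 2. *)
Lemma mean_value_le u (a b : R) (c : C) (e : R) : a < b -> continuous u ->
  (forall y, a < y < b -> exists2 v : C, is_derive y 1 u v & `|v - c| <= e) ->
  `|u b - u a - (b - a) *: c| <= 2 * e * (b - a).
Proof.
move=> ab cu H; have ba : 0 < b - a by rewrite subr_gt0.
have dv y : a < y < b -> is_derive y 1 u (derive1 u y) /\ `|derive1 u y - c| <= e.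
  move=> /H[v uv vc]; suff -> : derive1 u y = v by [].
  by rewrite derive1E; case: uv.
have [y1] := MVT ab (fun y yab => is_derive_Re (dv y yab).1)
  (continuous_subspaceT (continuous_Re cu)).
rewrite in_itv/= => /dv[_ c1] E1.
have [y2] := MVT ab (fun y yab => is_derive_Im (dv y yab).1)
  (continuous_subspaceT (continuous_Im cu)).
rewrite in_itv/= => /dv[_ c2] E2.
apply: le_trans (norm_le_ReIm _) _.
have -> : complex.Re (u b - u a - (b - a) *: c) =
  complex.Re (derive1 u y1 - c) * (b - a).
  rewrite [LHS]raddfB [in LHS]raddfB E1 raddfB mulrBl; congr (_ - _).
  by case: (c) => p q; exact: mulrC.
have -> : complex.Im (u b - u a - (b - a) *: c) =
  complex.Im (derive1 u y2 - c) * (b - a).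
  rewrite [LHS]raddfB [in LHS]raddfB E2 raddfB mulrBl; congr (_ - _).
  by case: (c) => p q; exact: mulrC.
rewrite !normrM (gtr0_norm ba) -mulrDl ler_wpM2r ?(ltW ba)//.
have := Rcomplex_norm_Re (derive1 u y1 - c).
have := Rcomplex_norm_Im (derive1 u y2 - c); lra.
Qed.

Lemma is_derive_removable u (x : R) (c : C) : continuous u ->
  (forall e : R, 0 < e -> exists2 d : R, 0 < d & forall y, y != x -> `|y - x| < d ->
    exists2 v : C, is_derive y 1 u v & `|v - c| <= e) ->
  is_derive x 1 u c.
Proof.
move=> cu H; apply/is_derive1P => e e0.
have e2 : 0 < e / 2 by lra.
have [d d0 Hd] := H _ e2; exists d => // y yx.
have ee : e = 2 * (e / 2) by field.
case: (ltgtP y x) => [yltx|xlty|->]; last by rewrite !subrr scale0r subrr !normr0 mulr0.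
- have -> : u y - u x - (y - x) *: c = - (u x - u y - (x - y) *: c).
    by rewrite !opprB -[in LHS](opprB x y) scaleNr opprK addrC addrA addrAC.
  have -> : `|y - x| = x - y by rewrite distrC gtr0_norm ?subr_gt0.
  rewrite normrN [in leRHS]ee.
  apply: mean_value_le => // z /andP[yz zx]; apply: Hd; first by rewrite lt_eqF.
  by move: yx; rewrite !ltr0_norm ?subr_lt0//; lra.
- have -> : `|y - x| = y - x by rewrite gtr0_norm ?subr_gt0.
  rewrite [in leRHS]ee.
  apply: mean_value_le => // z /andP[xz zy]; apply: Hd; first by rewrite gt_eqF.
  by move: yx; rewrite !gtr0_norm ?subr_gt0//; lra.
Qed.

(** Right difference quotients that converge locally uniformly to a continuous
    function also control the left ones, by moving the base point. *)
Lemma is_derive_uniform_right u (h : R -> C) : continuous h ->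
  (forall A e : R, 0 < e -> exists2 d : R, 0 < d & forall t x, 0 < t < d -> `|x| <= A ->
    `|u (x + t) - u x - t *: h x| <= e * t) ->
  forall x : R, is_derive x 1 u (h x).
Proof.
move=> ch H x; apply/is_derive1P => e e0.
have e2 : 0 < e / 2 by lra.
have [d d0 Hd] := H (`|x| + 1) _ e2.
have [d' d'0 Hd'] := (continuous_atP h x).1 (ch x) _ e2.
exists (Num.min (Num.min d d') 1); first by rewrite !lt_min d0 d'0 ltr01.
move=> y; rewrite !lt_min => /andP[/andP[yd yd'] y1].
case: (ltgtP y x) => [yltx|xlty|->]; last by rewrite !subrr scale0r subrr !normr0 mulr0.
- have xy : 0 < x - y by rewrite subr_gt0.
  rewrite distrC gtr0_norm// in yd.
  have yA : `|y| <= `|x| + 1.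
    by rewrite -(subrK x y) (le_trans (ler_normD _ _))//; lra.
  have := Hd (x - y) y; rewrite xy yd => /(_ isT yA).
  rewrite (addrC y) subrK => I1.
  have I2 := Hd' y yd'.
  have -> : u y - u x - (y - x) *: h x =
      - ((u x - u y - (x - y) *: h y) + (x - y) *: (h y - h x)).
    rewrite scalerBr -[in LHS](opprB x y) scaleNr opprK.
    by rewrite addrA subrK opprB opprB; rewrite addrC.
  have -> : `|y - x| = x - y by rewrite distrC gtr0_norm.
  rewrite normrN (le_trans (ler_normD _ _))// normrZ (gtr0_norm xy).
  have : (x - y) * `|h y - h x| <= (x - y) * (e / 2) by rewrite ler_wpM2l ?(ltW xy)// ltW.
  lra.
- have xy : 0 < y - x by rewrite subr_gt0.
  rewrite gtr0_norm// in yd *.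
  have := Hd (y - x) x; rewrite xy yd lerDl => /(_ isT ler01).
  rewrite (addrC x) subrK => I1; apply: le_trans I1 _.
  by rewrite ler_wpM2r ?(ltW xy)//; lra.
Qed.

Lemma uniform_right_is_derive u (h : R -> C) : continuous h ->
  (forall x : R, is_derive x 1 u (h x)) ->
  forall A e : R, 0 < e -> exists2 d : R, 0 < d & forall t x, 0 < t < d -> `|x| <= A ->
    `|u (x + t) - u x - t *: h x| <= e * t.
Proof.
move=> ch du A e e0; have e2 : 0 < e / 2 by lra.
have cu : continuous u by move=> x; exact: is_derive1_continuous (du x).
have [d d0 Hd] := continuous_locally_uniform ch A e2.
exists d => // t x /andP[t0 td] xA.
have tE : t = x + t - x by rewrite (addrC x) addrK.
have -> : e * t = 2 * (e / 2) * (x + t - x) by rewrite -tE; field.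
rewrite {2}tE; apply: mean_value_le => //; first by rewrite ltrDl.
move=> y /andP[xy yt]; exists (h y) => //.
by apply: Hd => //; rewrite gtr0_norm ?subr_gt0//; lra.
Qed.

End complex_derivatives.

(** * The domain of the perturbed derivative *)

Section primitive.
Variable R : realType.
Local Notation C := (Rcomplex R).
Variables (g : R -> C) (N : R).
Hypothesis gN : forall x, `|g x| <= N.
Hypothesis lg : loc_bounded_measurableC g.
Local Notation Z := (discontinuities g).

Definition primitive (x : R) : C := cint 0 x g.

Lemma primitiveB x y : primitive y - primitive x = cint x y g.
Proof. by rewrite /primitive (cint_cat 0 x y lg) addrC addKr. Qed.

Lemma primitive_continuous : continuous primitive.
Proof.
move=> x; apply/continuous_atP => e e0.
have N0 : 0 <= N by exact: le_trans (gN 0).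
have N1 : 0 < 2 * N + 1 by lra.
exists (e / (2 * N + 1)); first by rewrite divr_gt0.
move=> y yx; rewrite primitiveB.
apply: (@le_lt_trans _ _ (2 * N * `|y - x|)); first exact: cint_le_cst.
rewrite ltr_pdivlMr// mulrC in yx; apply: le_lt_trans yx.
by rewrite ler_wpM2r//; lra.
Qed.

Lemma cint_cst (c : C) x y : cint x y (fun=> c) = (y - x) *: c.
Proof. by rewrite /cint !rint_cst; case: c => a b /=; congr Complex; rewrite mulrC. Qed.

(** The average of [g] over a short interval ending at a continuity point. *)
Lemma primitive_is_derive x : ~ Z x -> is_derive x 1 primitive (g x).
Proof.
move=> /contrapT gx; apply/is_derive1P => e e0.
have e2 : 0 < e / 2 by lra.
have [d d0 Hd] := (continuous_atP g x).1 gx _ e2.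
exists d => // y yx; rewrite primitiveB -cint_cst -cintB//; last exact: cloc_cst.
have -> : e = 2 * (e / 2) by field.
apply: cint_le_cst.
  under eq_fun do rewrite -mulN1r.
  by apply: clocD => //; apply: clocM => //; exact: cloc_cst.
move=> z xzy; apply/ltW/Hd; apply: le_lt_trans yx.
by move: xzy; case: (leP x y) => xy /andP[xz zy]; [rewrite !ger0_norm|rewrite !ler0_norm]; lra.
Qed.

Hypothesis Z_discrete : Z `<=` isolated Z.

Lemma isolated_discontinuity x : Z x ->
  exists2 d : R, 0 < d & forall y, y != x -> `|y - x| < d -> ~ Z y.
Proof.
move=> /Z_discrete[_ [V /nbhs_ballP[d /= d0 xV] VZ]]; exists d => // y yx xy Zy.
have : (V `&` Z) y by split => //; apply: xV; rewrite /ball/= distrC.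
by rewrite VZ => /= /eqP; rewrite (negbTE yx).
Qed.

(** A discrete set has dense complement. *)
Lemma continuity_point_near x (d : R) : 0 < d -> exists2 y, ~ Z y & `|y - x| < d.
Proof.
move=> d0; have [Zx|nZx] := pselect (Z x); last by exists x => //; rewrite subrr normr0.
have [d' d'0 Hd'] := isolated_discontinuity Zx.
have m0 : 0 < Num.min d d' by rewrite lt_min d0.
have mE : x + Num.min d d' / 2 - x = Num.min d d' / 2 by rewrite (addrC x) addrK.
have m1 : `|x + Num.min d d' / 2 - x| < Num.min d d'.
  by rewrite mE gtr0_norm; lra.
move: (m1); rewrite lt_min => /andP[md md'].
exists (x + Num.min d d' / 2) => //; apply: Hd' => //.
by rewrite -subr_eq0 mE gt_eqF//; lra.
Qed.

Lemma continuous_eq_off_discontinuities (h k : R -> C) : continuous h -> continuous k ->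
  (forall x, ~ Z x -> h x = k x) -> h =1 k.
Proof.
move=> ch ck hk x; apply/eqP; rewrite -subr_eq0 -normr_le0 leNgt; apply/negP => neq.
have e2 : 0 < `|h x - k x| / 2 by lra.
have [d1 d10 H1] := (continuous_atP h x).1 (ch x) _ e2.
have [d2 d20 H2] := (continuous_atP k x).1 (ck x) _ e2.
have [|y nZy] := @continuity_point_near x (Num.min d1 d2); first by rewrite lt_min d10.
rewrite lt_min => /andP[/H1 h1 /H2 h2].
have := ler_normB (k y - k x) (h y - h x).
have -> : k y - k x - (h y - h x) = h x - k x by rewrite hk// opprB addrC subrKA.
lra.
Qed.

Variables (f : Cb R) (p : C).
Local Notation u := (fun y : R => f y + p * primitive y : C).

Let cu : continuous u.
Proof.
move=> x; apply: cvgD; first exact: Cb_continuous.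
by apply: Rcomplex_cvgZl; exact: primitive_continuous.
Qed.

Let k (x : R) : C := derive1 f x + p * g x.

(** Let [k = f' + p g], which is the derivative of [u] off [Z]. At a point of
    [Z] the jump condition makes both one-sided limits of [k] equal, so [u] is
    differentiable there as well. Points of [Z] may accumulate at a point [x]
    off [Z]; the continuity of [u'] at [x] still follows, since every value of
    [u'] is a limit of values of [k] at nearby points off [Z]. *)
Lemma corrected_derivative :
  C1b_off Z f ->
  (forall x, Z x ->
     [/\ cvg (derive1 f t @[t --> x^'-]), cvg (derive1 f t @[t --> x^'+]) &
         left_lim (derive1 f) x - right_lim (derive1 f) x =
         p * (right_lim g x - left_lim g x) :> C]) ->
  (forall x, Z x -> jump_discontinuity g x) ->
  exists h : Cb R, forall x : R, is_derive x 1 u (h x).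
Proof.
move=> [df cdf bdf] jf jg.
have du (x : R) : ~ Z x -> is_derive x 1 u (k x).
  move=> nZ; apply: is_deriveD.
    by rewrite derive1E; apply: DeriveDef => //; exact: df.
  by apply: is_derive_mulC; exact: primitive_is_derive.
have at_jump x : Z x -> exists c : C, forall e : R, 0 < e -> exists2 d : R, 0 < d &
    forall y, y != x -> `|y - x| < d -> ~ Z y /\ `|k y - c| <= e.
  move=> Zx; have [fl fr jfx] := jf x Zx; have [gl gr _] := jg x Zx.
  have kl : k t @[t --> x^'-] --> left_lim (derive1 f) x + p * left_lim g x.
    by apply: cvgD => //; apply: Rcomplex_cvgZl.
  have kr : k t @[t --> x^'+] --> right_lim (derive1 f) x + p * right_lim g x.
    by apply: cvgD => //; apply: Rcomplex_cvgZl.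
  have E : left_lim (derive1 f) x + p * left_lim g x =
      right_lim (derive1 f) x + p * right_lim g x :> C.
    apply/eqP; rewrite -subr_eq0 opprD addrACA jfx -mulrBr -mulrDr.
    by rewrite -[X in X + _]opprB addNr mulr0.
  exists (left_lim (derive1 f) x + p * left_lim g x) => e e0.
  have [d d0 Hd] := isolated_discontinuity Zx.
  move: kl => /cvgrPdist_le/(_ e e0)/at_leftP[d1 d10 Hd1].
  move: kr; rewrite -E => /cvgrPdist_le/(_ e e0)/at_rightP[d2 d20 Hd2].
  exists (Num.min d (Num.min d1 d2)); first by rewrite !lt_min d0 d10.
  move=> y yx; rewrite !lt_min => /and3P[yd yd1 yd2]; split; first exact: Hd.
  rewrite distrC; move: yx; rewrite neq_lt => /orP[yx|xy].
    by apply: Hd1; move: yd1; rewrite ltr0_norm ?subr_lt0//; lra.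
  by apply: Hd2; move: yd2; rewrite gtr0_norm ?subr_gt0//; lra.
have /choice[h dh] : forall x : R, exists c : C, is_derive x 1 u c.
  move=> x; have [Zx|nZx] := pselect (Z x); last by exists (k x); exact: du.
  have [c Hc] := at_jump x Zx; exists c; apply: is_derive_removable => // e e0.
  have [d d0 Hd] := Hc e e0; exists d => // y yx xy.
  by have [nZ kc] := Hd y yx xy; exists (k y) => //; exact: du.
have hk x : ~ Z x -> h x = k x.
  by move=> nZ; exact: is_derive1_unique (dh x) (du x nZ).
have h_jump x : Z x -> forall e : R, 0 < e -> exists2 d : R, 0 < d &
    forall y, y != x -> `|y - x| < d -> ~ Z y /\ `|k y - h x| <= e.
  move=> Zx; have [c Hc] := at_jump x Zx.
  suff -> : h x = c by [].
  apply: is_derive1_unique (dh x) _; apply: is_derive_removable => // e e0.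
  have [d d0 Hd] := Hc e e0; exists d => // y yx xy.
  by have [nZ kc] := Hd y yx xy; exists (k y) => //; exact: du.
(* Every value of [h] is approximated by values of [k] at nearby points off [Z]. *)
have approx x (d e : R) : 0 < d -> 0 < e ->
    exists2 y, ~ Z y & `|y - x| < d /\ `|k y - h x| <= e.
  move=> d0 e0; have [Zx|nZx] := pselect (Z x); last first.
    by exists x => //; rewrite hk// !subrr !normr0; split => //; exact: ltW.
  have [d' d'0 Hd'] := h_jump x Zx e e0.
  have m0 : 0 < Num.min d d' by rewrite lt_min d0.
  have mE : x + Num.min d d' / 2 - x = Num.min d d' / 2 by rewrite (addrC x) addrK.
  have m1 : `|x + Num.min d d' / 2 - x| < Num.min d d'.
    by rewrite mE gtr0_norm; lra.
  move: (m1); rewrite lt_min => /andP[md md'].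
  have [|nZ kh] := Hd' (x + Num.min d d' / 2) _ md'.
    by rewrite -subr_eq0 mE gt_eqF//; lra.
  by exists (x + Num.min d d' / 2).
have ch : continuous h.
  move=> x; apply/continuous_atP => e e0; have e2 : 0 < e / 2 by lra.
  have [Zx|nZx] := pselect (Z x).
    have [d d0 Hd] := h_jump x Zx _ e2; exists d => // y yx.
    have [->|ynx] := eqVneq y x; first by rewrite subrr normr0.
    by have [nZ kh] := Hd y ynx yx; rewrite hk//; lra.
  have ck : forall e : R, 0 < e -> exists2 d : R, 0 < d &
      forall y, ~ Z y -> `|y - x| < d -> `|k y - k x| <= e.
    move=> r r0; have kx : k t @[t --> within (~` Z) (nbhs x)] --> k x.
      apply: cvgD; first exact: ((subspace_continuousP _ _).1 cdf x nZx).
      by apply: Rcomplex_cvgZl; apply: cvg_within_filter; exact: contrapT nZx.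
    move: kx => /cvgrPdist_le/(_ r r0)/nbhs_ballP[d /= d0 Hd]; exists d => // y nZy yx.
    by rewrite distrC; apply: Hd => //; rewrite /ball/= distrC.
  have e4 : 0 < e / 4 by lra.
  have [d d0 Hd] := ck _ e4; exists (d / 2); first lra.
  move=> y yx; have d2 : 0 < d / 2 by lra.
  have [z nZz [zy kz]] := approx y _ _ d2 e4.
  have zx : `|z - x| < d.
    by rewrite -(subrKA y) (le_lt_trans (ler_normD _ _))//; lra.
  have := Hd z nZz zx; rewrite (hk x nZx) => I1.
  rewrite -(subrKA (k z)) (le_lt_trans (ler_normD _ _))// distrC; lra.
have hb : h \in @Cb_pred R.
  apply/mem_set; split => //; apply/Defs.bounded_funP.
  move: bdf => [m [_ Hm]].
  exists (m + 1 + `|p| * N + 1) => x.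
  have [y nZy [_ kh]] := approx x 1 1 ltr01 ltr01.
  have I1 : `|derive1 f y| <= m + 1 by apply: (Hm (m + 1)) => //; rewrite ltrDl.
  have I2 : `|p * g y : C| <= `|p| * N by rewrite Rcomplex_normM ler_wpM2l.
  rewrite -(subrK (k y) (h x)) (le_trans (ler_normD _ _))// distrC.
  have := ler_normD (derive1 f y) (p * g y : C); rewrite -/(k y); lra.
by exists (MkCb hb).
Qed.

(** Conversely [f = u - p G] inherits its regularity off [Z] from [u] and [G],
    and near a point of [Z] one has [f' = h - p g] with [h] continuous, so that
    the jump of [f'] is the opposite of that of [p g]. *)
Lemma corrected_derivative_domain (h : Cb R) :
  (forall x : R, is_derive x 1 u (h x)) ->
  (forall x, Z x -> jump_discontinuity g x) ->
  [/\ forall x, ~ Z x -> h x = derive1 f x + p * g x :> C,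
      C1b_off Z f &
      forall x, Z x ->
     [/\ cvg (derive1 f t @[t --> x^'-]), cvg (derive1 f t @[t --> x^'+]) &
         left_lim (derive1 f) x - right_lim (derive1 f) x =
         p * (right_lim g x - left_lim g x) :> C]].
Proof.
move=> du jg.
have df (x : R) : ~ Z x -> is_derive x 1 f (h x - p * g x).
  move=> nZ; have -> : (f : R -> C) = (fun y => u y + (- p) * primitive y : C).
    by apply/funext => y /=; rewrite mulNr addrK.
  rewrite -mulNr; apply: (is_deriveD (du x)).
  by apply: is_derive_mulC; exact: primitive_is_derive.
have dfE x : ~ Z x -> derive1 f x = h x - p * g x :> C.
  by move=> nZ; rewrite derive1E; case: (df x nZ).
split=> [x nZ||x Zx]; first by rewrite dfE// subrK.
  split=> [x nZ||].
  - by case: (df x nZ).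
  - apply: (@subspace_eq_continuous _ _ _ (fun x => h x - p * g x : C)).
      by move=> x /set_mem nZ; exact/esym/(dfE x nZ).
    apply: continuous_in_subspaceT => x; rewrite inE => nZ.
    apply: cvgB; first exact: Cb_continuous.
    by apply: Rcomplex_cvgZl; exact: contrapT nZ.
  - have [m hm] := Cb_bounded h.
    exists (m + `|p| * N); split; first exact: num_real.
    move=> b bm x nZ /=; apply: le_trans (ltW bm); rewrite dfE//.
    by rewrite (le_trans (ler_normB _ _))// lerD// Rcomplex_normM ler_wpM2l.
have [gl gr _] := jg x Zx; have [d d0 Hd] := isolated_discontinuity Zx.
have fl : derive1 f t @[t --> x^'-] --> (h x - p * left_lim g x : C).
  apply: (@cvg_trans _ ((fun t => h t - p * g t : C) @ x^'-)).
    apply: near_eq_cvg; apply/at_leftP; exists d => // y /andP[yd yx].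
    rewrite dfE//; apply: Hd; first by rewrite lt_eqF.
    by rewrite ltr0_norm ?subr_lt0//; lra.
  apply: cvgB; first by apply: cvg_at_left_filter; exact: Cb_continuous.
  exact: Rcomplex_cvgZl.
have fr : derive1 f t @[t --> x^'+] --> (h x - p * right_lim g x : C).
  apply: (@cvg_trans _ ((fun t => h t - p * g t : C) @ x^'+)).
    apply: near_eq_cvg; apply/at_rightP; exists d => // y /andP[xy yd].
    rewrite dfE//; apply: Hd; first by rewrite gt_eqF.
    by rewrite gtr0_norm ?subr_gt0//; lra.
  apply: cvgB; first by apply: cvg_at_right_filter; exact: Cb_continuous.
  exact: Rcomplex_cvgZl.
split; [exact: cvgP fl|exact: cvgP fr|].
rewrite {1}/left_lim {1}/right_lim (cvg_lim _ fl)// (cvg_lim _ fr)//.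
by rewrite mulrBr opprB addrC addrA subrK.
Qed.

End primitive.

(** * Generation *)

Section measurability.
Variable R : realType.
Local Notation C := (Rcomplex R).

Lemma measurable_continuous_off_countable (r : R -> R) (Z : set R) :
  countable Z -> (forall x, ~ Z x -> {for x, continuous r}) ->
  measurable_fun [set: R] r.
Proof.
move=> cZ cr.
have mcount (A : set R) : countable A -> measurable (A : set (measurableTypeR R)).
  by apply: countable_measurable => t; exact: measurable_set1.
have mZ := mcount _ cZ.
rewrite -(setUv Z); apply/measurable_funU => //; first exact: measurableC.
split.
  move=> _ Y mY; apply: mcount; apply: sub_countable cZ.
  by apply: subset_card_le => x [].
apply: subspace_continuous_measurable_fun; first exact: measurableC.
by apply: continuous_in_subspaceT => x /set_mem; exact: cr.
Qed.

(** A discrete subset of the line is countable. *)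
Lemma discrete_discontinuities_measurable (g : R -> C) (N : R) :
  (forall x, `|g x| <= N) ->
  discontinuities g `<=` isolated (discontinuities g) ->
  loc_bounded_measurableC g.
Proof.
move=> gN Zi; have cZ : countable (discontinuities g).
  by apply: sub_countable (countable_isolated (discontinuities g)); exact: subset_card_le.
split; (split; last first).
- by move=> A; exists N => x _; exact: le_trans (Rcomplex_norm_Re _) (gN x).
- apply: measurable_continuous_off_countable cZ _ => x /contrapT gx.
  apply/continuous_atP => e /((continuous_atP _ _).1 gx)[d d0 Hd]; exists d => // y /Hd.
  by apply: le_lt_trans; rewrite -raddfB; exact: Rcomplex_norm_Re.
- by move=> A; exists N => x _; exact: le_trans (Rcomplex_norm_Im _) (gN x).
- apply: measurable_continuous_off_countable cZ _ => x /contrapT gx.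
  apply/continuous_atP => e /((continuous_atP _ _).1 gx)[d d0 Hd]; exists d => // y /Hd.
  by apply: le_lt_trans; rewrite -raddfB; exact: Rcomplex_norm_Im.
Qed.

End measurability.

Section generator.
Variable R : realType.
Local Notation C := (Rcomplex R).

Lemma difference_quotient_le (S : R -> {linear Cb R -> Cb R}) (f h : Cb R) (t x e : R) :
  0 < t -> (`|difference_quotient S f t x - h x| <= e) =
    (`|S t f x - f x - t *: h x| <= e * t).
Proof.
move=> t0; have tn0 : t != 0 by rewrite gt_eqF.
have -> : S t f x - f x - t *: h x = t *: (difference_quotient S f t x - h x).
  have -> : difference_quotient S f t x = t^-1 *: (S t f x - f x).
    rewrite -[LHS]/((t^-1)%:C%C * (S t f x - f x) : C).
    case: (S t f x - f x) => a b; apply/eqP.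
    by rewrite eq_complex /= !mul0r subr0 addr0 !eqxx.
  by rewrite scalerBr scalerA mulfV// scale1r.
by rewrite normrZ gtr0_norm// mulrC ler_pM2r.
Qed.

Variables (g : R -> C) (N : R).
Hypothesis gN : forall x, `|g x| <= N.
Hypothesis lg : loc_bounded_measurableC g.
Variables (Phi : Cb R -> C) (M : R).
Hypothesis M0 : 0 <= M.
Hypothesis PhiD : forall f k : Cb R, Phi (f + k) = Phi f + Phi k.
Hypothesis PhiZ : forall (c : C) (f : Cb R), Phi (c *: f) = c * Phi f.
Hypothesis Phi_tight : tight_functional Phi M.
Local Notation S := (semigroup gN lg M0 PhiD PhiZ Phi_tight).
Local Notation u f := (fun y : R => f y + Phi f * primitive g y : C).

(** The increment of [f] under the semigroup is that of [u] under translation,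
    up to the remainder of the convolution. *)
Let quotient_split (f : Cb R) (t x : R) (c : C) :
  S t f x - f x - c = (S t f x - f (x + t) - Phi f * cint x (x + t) g) +
    (u f (x + t) - u f x - c).
Proof.
have -> : u f (x + t) - u f x = f (x + t) - f x + Phi f * cint x (x + t) g.
  by rewrite opprD addrACA -mulrBr primitiveB.
move: (S t f x) (f (x + t)) (f x) (Phi f * _ : C) => a b d q; ring.
Qed.

Lemma difference_quotient_cvg (f h : Cb R) :
  co_cvg (0 : R)^'+ (difference_quotient S f) h <->
  forall x : R, is_derive x 1 (u f) (h x).
Proof.
split=> [/co_cvgP H|du].
  apply: is_derive_uniform_right; first exact: Cb_continuous.
  move=> A e e0; have e2 : 0 < e / 2 by lra.
  have /at_rightP[d d0 Hd] := H A _ e2.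
  have [d' d'0 Hd'] := evolution_first_order gN lg M0 PhiD PhiZ Phi_tight f e2.
  exists (Num.min d d'); first by rewrite lt_min d0.
  move=> t x; rewrite lt_min => /and3P[t0 td td'] xA.
  have := Hd t; rewrite add0r t0 td => /(_ isT x xA).
  rewrite difference_quotient_le// => I1.
  have := Hd' t x; rewrite (ltW t0) td' => /(_ isT) I2.
  have -> : u f (x + t) - u f x - t *: h x = (S t f x - f x - t *: h x) -
      (S t f x - f (x + t) - Phi f * cint x (x + t) g).
    by rewrite quotient_split [RHS]addrC addKr.
  rewrite (le_trans (ler_normB _ _))//.
  by have -> : e * t = e / 2 * t + e / 2 * t by [field]; exact: lerD.
apply/co_cvgP => A e e0; have e2 : 0 < e / 2 by lra.
have [d d0 Hd] := uniform_right_is_derive (@Cb_continuous _ h) du A e2.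
have [d' d'0 Hd'] := evolution_first_order gN lg M0 PhiD PhiZ Phi_tight f e2.
apply/at_rightP; exists (Num.min d d'); first by rewrite lt_min d0.
move=> t; rewrite add0r lt_min => /and3P[t0 td td'] x xA.
rewrite difference_quotient_le// quotient_split (le_trans (ler_normD _ _))//.
have -> : e * t = e / 2 * t + e / 2 * t by field.
apply: lerD; first by apply: Hd'; rewrite (ltW t0).
by apply: Hd => //; rewrite t0.
Qed.

Lemma difference_quotient_bounded (f h : Cb R) :
  (forall x : R, is_derive x 1 (u f) (h x)) ->
  exists b : R, forall t : R, 0 < t <= 1 -> sup_norm (S t f - f) / t <= b.
Proof.
move=> du; have [m hm] := Cb_bounded h.
have [b Hb] := evolution_remainder_bound gN lg M0 PhiD PhiZ Phi_tight f.
exists (b + 2 * m) => t /andP[t0 t1]; rewrite ler_pdivrMr//.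
apply: sup_norm_le => x.
rewrite -[leLHS]/(`|S t f x - f x|) -[X in `|X|]subr0 quotient_split subr0.
rewrite (le_trans (ler_normD _ _))// mulrDl lerD//; first by apply: Hb; rewrite ltW.
have cu : continuous (u f) by move=> y; exact: is_derive1_continuous (du y).
have xt : x < x + t by rewrite ltrDl.
have := @mean_value_le _ (u f) x (x + t) 0 m xt cu.
rewrite scaler0 subr0 (addrC x t) addrK; apply => y _.
by exists (h y) => //; rewrite subr0.
Qed.

End generator.

Theorem mainTheorem3 (R : realType) (mu : complex_measure R)
  (mu_bounded : cmeasure_bounded mu) (mu_regular : cmeasure_regular mu)
  (g : R -> Rcomplex R)
  (g_bounded : bounded_fun g)
  (g_X_m1 : X_m1 (distribution_of g))
  (Z_discrete : discontinuities g `<=` isolated (discontinuities g))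
  (Z_jumps : forall x, discontinuities g x -> jump_discontinuity g x) :
  generates_bi_continuous_semigroup (opC_domain mu g) (opC mu g).
Proof.
have [N gN] := (Defs.bounded_funP g).1 g_bounded.
have lg := discrete_discontinuities_measurable gN Z_discrete.
have [M M0 tight] := cintegral_tight mu.
have PhiD (f k : Cb R) : cintegral mu (f + k : Cb R) = cintegral mu f + cintegral mu k.
  exact: cintegralD.
have PhiZ (c : Rcomplex R) (f : Cb R) :
    cintegral mu (c *: f : Cb R) = c * cintegral mu f.
  exact: cintegralZ.
pose S := semigroup gN lg M0 PhiD PhiZ tight.
have opC_derivative (f : Cb R) : opC_domain mu g f -> forall x : R,
    is_derive x 1 (fun y : R => f y + cintegral mu f * primitive g y : Rcomplex R)
      (opC mu g f x).
  move=> [fb fj].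
  have [h dh] := corrected_derivative gN lg Z_discrete fb fj Z_jumps.
  have [hE _ _] := corrected_derivative_domain gN lg Z_discrete dh Z_jumps.
  have oE : forall x, ~ discontinuities g x ->
      opC mu g f x = derive1 f x + (cintegral mu f * g x : Rcomplex R).
    exact: (@getPex _ [set h : Cb R | forall x, ~ discontinuities g x ->
      h x = derive1 f x + (cintegral mu f * g x : Rcomplex R)] (ex_intro _ h hE)).
  suff -> : opC mu g f = h by [].
  apply: CbP; apply: (continuous_eq_off_discontinuities Z_discrete).
  - exact: Cb_continuous.
  - exact: Cb_continuous.
  - by move=> x nZ; rewrite oE// hE.
exists S; split; first exact: semigroup_bi_continuous.
split=> [|f /opC_derivative df]; last exact/difference_quotient_cvg.
apply/seteqP; split=> [f /opC_derivative df|f [[h hf] _]].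
  split; last exact: difference_quotient_bounded df.
  by exists (opC mu g f); exact/difference_quotient_cvg.
have df := (difference_quotient_cvg gN lg M0 PhiD PhiZ tight f h).1 hf.
by have [_ fb fj] := corrected_derivative_domain gN lg Z_discrete df Z_jumps.
Qed.
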